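(* Let $$F_{\mathbb{N}+\mathbb{Z}i}=\left\{z\in\mathbb{C}:\ z=\cfrac{1}{b_1+\cfrac{1}{b_2+\cfrac{1}{\ddots}}},\ b_n\in\mathbb{N}+\mathbb{Z}i\text{ for all }n\in\mathbb{N}\right\}$$ and let $h=\dim_{\mathrm H}F_{\mathbb{N}+\mathbb{Z}i}$. Then $$\dim_{\mathrm A}^\theta F_{\mathbb{N}+\mathbb{Z}i}=\begin{cases}h+\frac{\theta}{1-\theta}(2-h),&0<\theta<1/2,\\ 2,&1/2\le\theta<1.\end{cases}$$
   Context: $\mathbb{N}=\{1,2,3,\dots\}$, $\mathbb{N}+\mathbb{Z}i=\{m+ni:m\in\mathbb{N},n\in\mathbb{Z}\}$, and $\mathbb{C}$ is identified with $\mathbb{R}^2$. The set $F_{\mathbb{N}+\mathbb{Z}i}$ is the limit set of the conformal iterated function system $\{S_b(z)=1/(b+z):b\in(\mathbb{N}+\mathbb{Z}i)\setminus\{1\}\}\cup\{S_{1b}(z)=\frac{1}{b+\frac{1}{1+z}}:b\in\mathbb{N}+\mathbb{Z}i\}$. $\dim_{\mathrm H}$ is Hausdorff dimension. For a non-empty bounded set $E$ and $\theta\in(0,1)$, the Assouad spectrum is $\dim_{\mathrm A}^\theta E=\inf\{\alpha:\exists C>0\ \forall x\in E\ \forall\,0<R\le1,\ N_{R^{1/\theta}}(B(x,R)\cap E)\le CR^{\alpha(1-1/\theta)}\}$, where $B(x,R)$ is the open ball and $N_r(\cdot)$ is the smallest number of balls of radius $r$ needed to cover a set. *)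

(* Defs.v *)
(* MathComp-Analysis; the complex plane is [R[i]] for [R : realType]. *)
From HB Require Import structures.
From mathcomp Require Import all_boot all_order all_algebra.
From mathcomp Require Import complex.
From mathcomp Require Import all_classical all_reals all_analysis.

Set Implicit Arguments.
Unset Strict Implicit.
Unset Printing Implicit Defensive.

Import Order.TTheory GRing.Theory Num.Theory numFieldNormedType.Exports.
Import ComplexField.Normc.

Local Open Scope classical_set_scope.
Local Open Scope complex_scope.
Local Open Scope ring_scope.

(* The Euclidean topology and metric of the plane. Its distance is
   [R[i]]-valued, so that the open disc of radius [r : R] about [x] is
   [ball x r%:C]; the real-valued modulus is [normc]. *)
HB.instance Definition _ (R : realType) := NormedModule.copy R[i] R[i]^o.
HB.instance Definition _ (R : realType) := Metric.copy R[i] R[i]^o.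

Section ContinuedFractions.
Variable R : realType.

Definition NplusZi : set R[i] :=
  [set b : R[i] | exists (m : nat) (n : int), (0 < m)%N /\
     b = (m%:R : R) +i* (n%:~R : R)].

(* [convergent b n] is 1/(b_1 + 1/(b_2 + ... + 1/b_n)), where b_j is
   [b j.-1]. For digits in N + Zi every denominator has real part at least 1,
   so that the convention 0^-1 = 0 plays no role. *)
Fixpoint convergent (b : nat -> R[i]) (n : nat) : R[i] :=
  if n is n'.+1 then (b 0%N + convergent (fun k => b k.+1) n')^-1 else 0.

Definition F_NplusZi : set R[i] :=
  [set z | exists b : nat -> R[i],
     (forall n, NplusZi (b n)) /\ convergent b n @[n --> \oo] --> z].

End ContinuedFractions.

Arguments NplusZi R : clear implicits.
Arguments F_NplusZi R : clear implicits.

Section HausdorffDimension.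
Variable R : realType.
Implicit Types (E U : set R[i]) (s delta : R).

Definition diam U : \bar R :=
  ereal_sup [set (normc (xy.1 - xy.2))%:E | xy in U `*` U].

(* The empty set is given weight 0 for every [s], so that finite covers may be
   completed with empty sets even when s = 0. *)
Definition diam_pow s U : \bar R :=
  if `[< U = set0 >] then 0%E else poweR (diam U) s.

Definition hausdorff_premeasure s delta E : \bar R :=
  ereal_inf [set (\sum_(0 <= k <oo) diam_pow s (U k))%E |
    U in [set U : (set R[i])^nat |
      E `<=` \bigcup_k U k /\ forall k, (diam (U k) <= delta%:E)%E]].

Definition hausdorff_measure s E : \bar R :=
  ereal_sup [set hausdorff_premeasure s delta E | delta in [set d : R | 0 < d]].

Definition hausdorff_dim E : \bar R :=
  ereal_inf [set s%:E | s in [set s : R |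
    0 <= s /\ hausdorff_measure s E = 0%E]].

End HausdorffDimension.

Section AssouadSpectrum.
Variable R : realType.
Implicit Types (E A : set R[i]) (r theta : R).

(* The infimum is that of a set of natural numbers, hence a minimum, unless [A]
   has no finite cover, in which case it is +oo. *)
Definition covering_number r A : \bar R :=
  ereal_inf [set n%:R%:E | n in [set n : nat |
    exists c : 'I_n -> R[i], A `<=` \bigcup_k ball (c k) r%:C]].

Definition assouad_spectrum theta E : \bar R :=
  ereal_inf [set alpha%:E | alpha in [set alpha : R |
    exists2 C : R, 0 < C &
      forall (x : R[i]) (rho : R), E x -> 0 < rho <= 1 ->
        (covering_number (rho `^ (1 / theta)) (ball x rho%:C `&` E) <=
           (C * rho `^ (alpha * (1 - 1 / theta)))%:E)%E]].

End AssouadSpectrum.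

(* Main.v *)
(* Let d_w be the size of the cylinder of a finite word w of digits. Bounded
   distortion makes d multiplicative up to constants, and cylinders of the same
   length are separated.

   Upper bound. If sum_w d_w^s over the words w of some length is large, then
   finitely many of these words generate a limit set which carries a measure of
   exponent s, so that H^s(F) > 0. Hence, for s > h, the sums over words of a
   given length are bounded and, for larger s, the sum over all words is finite.
   The set F is covered at scale r by covering, for every word v with d_v >= r,
   the union of the subcylinders smaller than r, which needs about d_v / r balls.
   For the part of F in a ball of radius R, with r <= R^2, this amounts to
   summing d_v^s r^-s, and the sum is governed by the cylinders at which the size
   passes below R: it is at most C R^(2s-2) r^-s.

   Lower bound. Near 0 there are about R^-2 images of F of size about R^2, for
   the digits of modulus about 1/R. Each needs at least (R^2/r)^t balls of radius
   r for t < h, since the lower box dimension is at least h. When theta >= 1/2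
   these images fill the disc of radius R at scale r. *)

Require Import Defs.
From mathcomp Require Import all_boot all_order all_algebra.
From mathcomp Require Import complex.
From mathcomp Require Import all_classical all_reals all_analysis.
From mathcomp Require Import ring lra zify.
Set Implicit Arguments.
Unset Strict Implicit.
Unset Printing Implicit Defensive.
Import Order.TTheory GRing.Theory Num.Theory numFieldNormedType.Exports.
Import ComplexField.Normc.
Local Open Scope classical_set_scope.
Local Open Scope complex_scope.
Local Open Scope ring_scope.

(** No pressure function or induced system is used. The digit 1 does not contract uniformly, as 1/(1
    + z) has derivative of modulus 1 at 0, but two consecutive digits always do. So weights decay
    geometrically with the length, and raising the exponent slightly turns bounded sums over each
    length into a convergent sum over all words. The measure of exponent s is Lebesgue measure on
    [0, 1), carried to F by expanding t in blocks that are words of digits. The main obstacle is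
    tangency: the translates of the disc by neighbouring digits touch, so cylinders of equal length
    are apart only at points of positive depth. The remedies are to append a digit that maps
    strictly inside, to move points towards the centre, or to space the digits by at least 2. The
    range 1 < s < 2 comes from the children of one word: s > 1 controls the small ones and s < 2 the
    large ones. Words of length one give h >= 1, and for h = 2 the trivial upper bound is already
    the claimed value. *)

#[local] Arguments normc : simpl never.

(** * The real-valued modulus of the plane *)

Section Modulus.
Variable R : realType.
Implicit Types x y z : R[i].

Lemma normcC1 : normc (1 : R[i]) = 1.
Proof. exact: normc1. Qed.

Lemma ballC x y (r : R) : ball x r%:C y <-> normc (x - y) < r.
Proof. by rewrite -ball_normE /ball_ /=; case: (x - y) => a b; rewrite ltcE /= eqxx. Qed.

Lemma normc_ge0 x : 0 <= normc x.
Proof. by case: x => a b; exact: sqrtr_ge0. Qed.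

Lemma sqr_normc_ReIm x : normc x ^+ 2 = complex.Re x ^+ 2 + complex.Im x ^+ 2.
Proof. by case: x => a b; rewrite sqr_sqrtr ?addr_ge0 ?sqr_ge0. Qed.

Lemma normc_le_sqr x (r : R) : 0 <= r -> normc x ^+ 2 <= r ^+ 2 -> normc x <= r.
Proof. by move=> r0; rewrite ler_pXn2r ?nnegrE ?normc_ge0. Qed.

Lemma normc_ge_sqr x (r : R) : 0 <= r -> r ^+ 2 <= normc x ^+ 2 -> r <= normc x.
Proof. by move=> r0; rewrite ler_pXn2r ?nnegrE ?normc_ge0. Qed.

Lemma normc_distC x y : normc (x - y) = normc (y - x).
Proof. by rewrite -normcN opprB. Qed.

Lemma normc_triangle y x z : normc (x - z) <= normc (x - y) + normc (y - z).
Proof. by rewrite -[x - z](subrKA y) le_normcD. Qed.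

Lemma normc_gt0 x : (0 < normc x) = (x != 0).
Proof.
rewrite lt_neqAle normc_ge0 andbT eq_sym; apply/idP/idP; apply: contra.
- by move/eqP->; rewrite normc0.
- by move/eqP/eq0_normc->.
Qed.

Lemma ReD x y : complex.Re (x + y) = complex.Re x + complex.Re y.
Proof. by case: x y => [a b] [c d]. Qed.
Lemma ImD x y : complex.Im (x + y) = complex.Im x + complex.Im y.
Proof. by case: x y => [a b] [c d]. Qed.
Lemma ReN x : complex.Re (- x) = - complex.Re x.
Proof. by case: x. Qed.
Lemma ImN x : complex.Im (- x) = - complex.Im x.
Proof. by case: x. Qed.

Lemma Re_le_normc x : `|complex.Re x| <= normc x.
Proof.
apply: normc_ge_sqr; rewrite ?normr_ge0// real_normK ?num_real//.
by rewrite sqr_normc_ReIm lerDl sqr_ge0.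
Qed.
Lemma Im_le_normc x : `|complex.Im x| <= normc x.
Proof.
apply: normc_ge_sqr; rewrite ?normr_ge0// real_normK ?num_real//.
by rewrite sqr_normc_ReIm lerDr sqr_ge0.
Qed.
Lemma normc_le_ReIm x : normc x <= `|complex.Re x| + `|complex.Im x|.
Proof.
apply: normc_le_sqr; first exact: addr_ge0.
rewrite sqr_normc_ReIm -(real_normK (num_real (complex.Re x))).
rewrite -(real_normK (num_real (complex.Im x))) sqrrD.
have := mulr_ge0 (normr_ge0 (complex.Re x)) (normr_ge0 (complex.Im x)); lra.
Qed.

End Modulus.

(** * Cylinder maps: distortion, decay and separation *)

Section ContinuedFractionMaps.
Variable R : realType.
Implicit Types (z : R[i]) (w u v : seq R[i]).

(* [0 <= depth z] is the closed disc of diameter [0, 1]: it contains F and is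
   mapped into itself by [z |-> 1/(b + z)] for every digit [b]. *)
Definition depth z : R := complex.Re z - normc z ^+ 2.

Definition digits w := {in w, forall b, NplusZi R b}.

Fixpoint cfmap w z : R[i] := if w is b :: w' then (b + cfmap w' z)^-1 else z.

(** The chain-rule product, equal to q_n + q_(n-1) z: the derivative of [cfmap w] at z has modulus
    |[cfden w z]|^-2. *)
Fixpoint cfden w z : R[i] :=
  if w is b :: w' then (b + cfmap w' z) * cfden w' z else 1.

(* [|q_n|^-2], with [q_n] the denominator of the convergent of the word [w]:
   the size of the image of the disc by [cfmap w], up to a constant. *)
Definition weight w : R := (normc (cfden w 0) ^+ 2)^-1.

Lemma digits_cons b w : digits (b :: w) <-> NplusZi R b /\ digits w.
Proof.
split=> [h|[hb h] c]; last by rewrite inE => /orP[/eqP->|/h].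
by split=> [|c cw]; apply: h; rewrite inE ?eqxx ?cw ?orbT.
Qed.

Lemma digits_cat u v : digits (u ++ v) <-> digits u /\ digits v.
Proof.
split=> [h|[h h'] c]; last by rewrite mem_cat => /orP[/h|/h'].
by split=> c cw; apply: h; rewrite mem_cat cw ?orbT.
Qed.

Lemma digits_rcons w b : digits (rcons w b) <-> NplusZi R b /\ digits w.
Proof.
by rewrite -cats1 digits_cat digits_cons; split=> [[?[? _]]|[? ?]]; split.
Qed.

Lemma NplusZi_Re b : NplusZi R b -> 1 <= complex.Re b.
Proof. by move=> [m [n [m0 ->]]] /=; rewrite ler1n. Qed.

Lemma Re_depth z : 0 <= depth z -> 0 <= complex.Re z.
Proof. by rewrite /depth subr_ge0; apply: le_trans; exact: sqr_ge0. Qed.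

Lemma normc_depth z : 0 <= depth z -> normc z <= 1.
Proof.
rewrite /depth subr_ge0 => h.
have := Re_le_normc z; have := ler_norm (complex.Re z); have := normc_ge0 z.
nra.
Qed.

Lemma depth0 : depth 0 = 0.
Proof. by rewrite /depth normc0 expr0n subr0. Qed.

Lemma depthE z : depth z = 4^-1 - normc (z - (2^-1)%:C) ^+ 2.
Proof. by rewrite /depth !sqr_normc_ReIm ReD ReN ImD ImN /=; field. Qed.

(** With t the distance to the centre, this is (t - 1/2)^2 >= 0. It makes [depth] a lower bound for
    the distance to the boundary circle. *)
Lemma dist_half z : 0 <= depth z -> normc (z - (2^-1)%:C) <= 2^-1 - depth z.
Proof.
rewrite depthE => h; have h1 : normc (z - (2^-1)%:C) <= 2^-1.
  apply: normc_le_sqr => //; rewrite (_ : 2^-1 ^+ 2 = 4^-1); last by field.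
  by rewrite -subr_ge0.
have := normc_ge0 (z - (2^-1)%:C); move: h h1; move: (normc _) => t; nra.
Qed.

Lemma normc_ge1 z : 1 <= complex.Re z -> 1 <= normc z.
Proof. by move=> h; rewrite (le_trans h)// (le_trans (ler_norm _))// Re_le_normc. Qed.

Lemma Re_inv z : complex.Re z^-1 = complex.Re z / normc z ^+ 2.
Proof. by rewrite sqr_normc_ReIm; case: z. Qed.

Lemma depth_inv z : 1 <= complex.Re z ->
  depth z^-1 = (complex.Re z - 1) / normc z ^+ 2.
Proof.
by move=> h; rewrite /depth Re_inv normcV exprVn -{2}[_^-1]mul1r -mulrBl.
Qed.

Lemma depth_inv_ge0 z : 1 <= complex.Re z -> 0 <= depth z^-1.
Proof. by move=> h; rewrite depth_inv// divr_ge0 ?sqr_ge0 ?subr_ge0. Qed.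

Lemma Re_add_depth b z : NplusZi R b -> 0 <= depth z -> 1 <= complex.Re (b + z).
Proof.
by move=> /NplusZi_Re hb /Re_depth hz; rewrite ReD; lra.
Qed.

Lemma normc_add_depth b z : NplusZi R b -> 0 <= depth z -> 1 <= normc (b + z).
Proof. by move=> hb hz; apply/normc_ge1/Re_add_depth. Qed.

Lemma cfmap_cat u v z : cfmap (u ++ v) z = cfmap u (cfmap v z).
Proof. by elim: u => //= b u ->. Qed.

Lemma cfden_cat u v z : cfden (u ++ v) z = cfden u (cfmap v z) * cfden v z.
Proof. by elim: u => [|b u IH] /=; rewrite ?mul1r// IH cfmap_cat mulrA. Qed.

Lemma cfmap_depth w z : digits w -> 0 <= depth z -> 0 <= depth (cfmap w z).
Proof.
elim: w => //= b w IH /digits_cons[hb hw] hz.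
by apply/depth_inv_ge0/Re_add_depth => //; apply: IH.
Qed.

Lemma normc_cfden_ge1 w z : digits w -> 0 <= depth z -> 1 <= normc (cfden w z).
Proof.
elim: w => [|b w IH] /=; first by rewrite normcC1.
move=> /digits_cons[hb hw] hz; rewrite normcM -[1]mulr1 ler_pM//.
- by apply: normc_add_depth => //; apply: cfmap_depth.
- exact: IH.
Qed.

Lemma normc_cfden_gt0 w z : digits w -> 0 <= depth z -> 0 < normc (cfden w z).
Proof. by move=> hw hz; apply: lt_le_trans (normc_cfden_ge1 hw hz). Qed.

(** The exact difference formula for Moebius maps; with bounded distortion it shows that [cfmap w]
    scales all distances by about [weight w]. *)
Lemma cfmapB w z z' : digits w -> 0 <= depth z -> 0 <= depth z' ->
  normc (cfmap w z - cfmap w z') =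
  normc (z - z') / (normc (cfden w z) * normc (cfden w z')).
Proof.
elim: w => [|b w IH] /=; first by rewrite normcC1 mulr1 divr1.
move=> /digits_cons[hb hw] hz hz'.
set s := cfmap w z; set s' := cfmap w z'.
have hs : 0 < normc (b + s).
  by rewrite (lt_le_trans ltr01)// normc_add_depth//; apply: cfmap_depth.
have hs' : 0 < normc (b + s').
  by rewrite (lt_le_trans ltr01)// normc_add_depth//; apply: cfmap_depth.
have -> : (b + s)^-1 - (b + s')^-1 = (s' - s) / ((b + s) * (b + s')).
  rewrite normc_gt0 in hs; rewrite normc_gt0 in hs'; field.
  by rewrite hs hs'.
rewrite !normcM normcV !normcM normc_distC /s /s' IH//.
have h1 := normc_cfden_gt0 hw hz; have h2 := normc_cfden_gt0 hw hz'.
by rewrite -/s -/s'; field; rewrite !gt_eqF.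
Qed.

(** One inversion gives depth (1/v) = (Re v - 1) / |v|^2, and for v = b + s the numerator is at
    least Re s >= depth s. Iterating multiplies the denominators. *)
Lemma depth_cfmap w z : digits w -> 0 <= depth z ->
  depth z / normc (cfden w z) ^+ 2 <= depth (cfmap w z).
Proof.
elim: w => [|b w IH] /=; first by rewrite normcC1 expr1n divr1.
move=> /digits_cons[hb hw] hz.
have {}IH := IH hw hz; have hs := cfmap_depth hw hz.
set s := cfmap w z in IH hs *.
have h1 := normc_add_depth hb hs.
have h2 := normc_cfden_gt0 hw hz.
rewrite depth_inv; last exact: Re_add_depth.
rewrite normcM exprMn invfM mulrCA [X in _ <= X]mulrC.
rewrite ler_wpM2l// ?invr_ge0 ?sqr_ge0//.
apply: le_trans IH _; rewrite /depth ReD.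
by have := NplusZi_Re hb; have := sqr_ge0 (normc s); lra.
Qed.

(** The real part of t z is at least -1/4: the product of the real parts is nonnegative and the
    imaginary parts are at most 1/2 in modulus. *)
Lemma normc_1M_depth z t : 0 <= depth z -> 0 <= depth t ->
  3 / 4 <= normc (1 + t * z) <= 2.
Proof.
move=> hz ht; apply/andP; split; last first.
  rewrite (le_trans (le_normcD _ _))// normcC1 normcM.
  by have := normc_depth hz; have := normc_depth ht; have := normc_ge0 z;
    have := normc_ge0 t; nra.
apply: le_trans (Re_le_normc _); apply: le_trans (ler_norm _).
move: hz ht; rewrite !depthE !sqr_normc_ReIm; case: z t => [x y] [u v] /=.
rewrite !subr0 !subr_ge0 => hz ht.
have hx : 0 <= x by nra.
have hu : 0 <= u by nra.
have hy : y ^+ 2 <= 4^-1 by have := sqr_ge0 (x - 2^-1); lra.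
have hv : v ^+ 2 <= 4^-1 by have := sqr_ge0 (u - 2^-1); lra.
have := mulr_ge0 hu hx; have := sqr_ge0 (v - y); rewrite sqrrB; lra.
Qed.

(* [t] is [q_(n-1) / q_n], which lies in the disc by the recurrence
   [q_(n+1) / q_n = b + q_(n-1) / q_n]; this makes the distortion bounded. *)
Lemma cfden_affine w : digits w ->
  exists2 t, 0 <= depth t & forall z, 0 <= depth z -> cfden w z = cfden w 0 * (1 + t * z).
Proof.
elim/last_ind: w => [|w b IH].
  by exists 0 => [|z _]; rewrite ?depth0//= mul0r addr0 mulr1.
move=> /digits_rcons[hb hw]; have [t ht h] := IH hw.
have hbt := normc_add_depth hb ht.
exists (b + t)^-1; first exact/depth_inv_ge0/Re_add_depth.
move=> z hz; rewrite -cats1 !cfden_cat /= !mulr1 addr0.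
have hb0 : 0 <= depth (0 : R[i]) by rewrite depth0.
have hbz := normc_add_depth hb hz; have hb1 := normc_add_depth hb hb0.
rewrite addr0 in hb1.
have hbi : 0 <= depth b^-1 by apply/depth_inv_ge0/NplusZi_Re.
rewrite (h _ (depth_inv_ge0 (Re_add_depth hb hz))) (h _ hbi).
have : 0 < normc (b + t) by apply: lt_le_trans hbt.
have : 0 < normc (b + z) by apply: lt_le_trans hbz.
have : 0 < normc b by apply: lt_le_trans hb1.
by rewrite !normc_gt0 => n1 n2 n3; field; rewrite n1 n2 n3.
Qed.

Lemma weight_gt0 w : digits w -> 0 < weight w.
Proof.
by move=> hw; rewrite invr_gt0 exprn_gt0// normc_cfden_gt0// depth0.
Qed.

Lemma weight_le1 w : digits w -> weight w <= 1.
Proof.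
by move=> hw; rewrite invf_le1 ?exprn_ege1 ?exprn_gt0 ?normc_cfden_ge1
  ?normc_cfden_gt0// depth0.
Qed.

Lemma weight_nil : weight [::] = 1.
Proof. by rewrite /weight /= normcC1 expr1n invr1. Qed.

Lemma distortion w z : digits w -> 0 <= depth z ->
  weight w / 4 <= (normc (cfden w z) ^+ 2)^-1 <= 16 / 9 * weight w.
Proof.
move=> hw hz; have [t ht ->//] := cfden_affine hw.
have /andP[h1 h2] := normc_1M_depth hz ht.
rewrite normcM exprMn invfM -/(weight w).
have w0 := weight_gt0 hw.
set n := normc _ in h1 h2 *.
have n0 : 0 < n by lra.
have -> : weight w / 4 = weight w * (2 ^+ 2)^-1 by congr (_ * _); field.
rewrite [16 / 9 * _]mulrC !ler_pM2l//.
have -> : 16 / 9 = (3 / 4 : R) ^- 2 by field.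
by rewrite !lef_pV2 ?posrE ?exprn_gt0// !ler_pXn2r ?nnegrE// ?h1 ?h2// ltW.
Qed.

Lemma weight_cat u v : digits u -> digits v ->
  weight u * weight v / 4 <= weight (u ++ v) <= 16 / 9 * (weight u * weight v).
Proof.
move=> hu hv.
have h0 : 0 <= depth (0 : R[i]) by rewrite depth0.
have /andP[h1 h2] := distortion hu (cfmap_depth hv h0).
rewrite ![weight (u ++ v)]/weight cfden_cat normcM exprMn invfM -/(weight v).
have v0 := weight_gt0 hv.
by rewrite mulrAC ler_pM2r// h1 mulrA ler_pM2r.
Qed.

(** Here t is q_(n-1) / q_n, by the recurrence q_(n+1) = q_n (b + q_(n-1) / q_n). *)
Lemma weight_rcons w b : digits w -> NplusZi R b -> exists2 t, 0 <= depth t &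
  weight (rcons w b) = weight w / normc (b + t) ^+ 2.
Proof.
move=> hw hb; have [t ht h] := cfden_affine hw; exists t => //.
have hb1 := normc_ge1 (NplusZi_Re hb).
rewrite /weight -cats1 cfden_cat /= addr0 mulr1 h; last first.
  by apply/depth_inv_ge0/NplusZi_Re.
have b0 : b != 0 by rewrite -normc_gt0; apply: lt_le_trans hb1.
have -> : cfden w 0 * (1 + t * b^-1) * b = cfden w 0 * (b + t) by field.
by rewrite normcM exprMn invfM.
Qed.

Lemma weight_rcons_le w b : digits w -> NplusZi R b ->
  weight (rcons w b) <= weight w.
Proof.
move=> hw hb; have [t ht ->] := weight_rcons hw hb.
have h := normc_add_depth hb ht.
apply: ler_piMr; first exact/ltW/weight_gt0.
by rewrite invf_le1 ?exprn_ege1// exprn_gt0// (lt_le_trans ltr01).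
Qed.

Lemma cfmapB_le w z z' : digits w -> 0 <= depth z -> 0 <= depth z' ->
  normc (cfmap w z - cfmap w z') <= 16 / 9 * weight w * normc (z - z').
Proof.
move=> hw hz hz'; rewrite cfmapB// mulrC ler_wpM2r ?normc_ge0//.
have /andP[_ h1] := distortion hw hz; have /andP[_ h2] := distortion hw hz'.
have p1 := normc_cfden_gt0 hw hz; have p2 := normc_cfden_gt0 hw hz'.
rewrite -exprVn in h1; rewrite -exprVn in h2; rewrite invfM.
have := sqr_ge0 ((normc (cfden w z))^-1 - (normc (cfden w z'))^-1).
by rewrite sqrrB; lra.
Qed.

Lemma cfmapB_ge w z z' : digits w -> 0 <= depth z -> 0 <= depth z' ->
  weight w / 4 * normc (z - z') <= normc (cfmap w z - cfmap w z').
Proof.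
move=> hw hz hz'; rewrite cfmapB// [leRHS]mulrC ler_wpM2r ?normc_ge0//.
have /andP[h1 _] := distortion hw hz; have /andP[h2 _] := distortion hw hz'.
have w0 := weight_gt0 hw.
have p1 := normc_cfden_gt0 hw hz; have p2 := normc_cfden_gt0 hw hz'.
rewrite -ler_sqr ?nnegrE ?invr_ge0 ?mulr_ge0 ?normc_ge0//; last by lra.
have -> : (normc (cfden w z) * normc (cfden w z'))^-1 ^+ 2 =
    normc (cfden w z) ^- 2 * normc (cfden w z') ^- 2.
  by rewrite invfM exprMn !exprVn.
by rewrite [leLHS]expr2 ler_pM//; lra.
Qed.

(** With v = b + z and N = |v|^2, the real part of a + 1/v is at least 1 + 1/N, and (1 + 1/N)^2 N =
    N + 2 + 1/N. *)
Lemma cfden2 a b z : NplusZi R a -> NplusZi R b -> 0 <= depth z ->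
  2 <= normc ((a + (b + z)^-1) * (b + z)) ^+ 2.
Proof.
move=> /NplusZi_Re ha hb hz; rewrite normcM exprMn.
have hv := Re_add_depth hb hz; have n1 := normc_ge1 hv.
move: (b + z) hv n1 => v hv n1.
have h1 : 1 + complex.Re v / normc v ^+ 2 <= normc (a + v^-1).
  apply: le_trans (Re_le_normc _); apply: le_trans (ler_norm _).
  by rewrite ReD Re_inv; lra.
have n2 : 0 < normc v ^+ 2 by rewrite exprn_gt0//; lra.
set N := normc v ^+ 2 in h1 n2 *.
have h2 : 1 + N^-1 <= normc (a + v^-1).
  by apply: le_trans h1; rewrite lerD2l ler_peMl// invr_ge0 ltW.
have iN : N * N^-1 = 1 by rewrite divff ?gt_eqF.
have h3 : (1 + N^-1) ^+ 2 <= normc (a + v^-1) ^+ 2.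
  by rewrite ler_sqr ?nnegrE ?normc_ge0// addr_ge0// invr_ge0 ltW.
apply: le_trans (ler_wpM2r (ltW n2) h3).
have : 0 < N^-1 by rewrite invr_gt0.
have -> : (1 + N^-1) ^+ 2 * N = N + 2 * (N * N^-1) + N * N^-1 * N^-1 by ring.
by rewrite iN; lra.
Qed.

(** The induction removes two digits at a time: by [cfden2] they cost a factor 1/2 <= (3/4)^2. The
    constant 4/3 accounts for a single leftover digit. *)
Lemma weight_decay w : digits w -> weight w <= 4 / 3 * (3 / 4) ^+ size w.
Proof.
have key z n : (size w <= n)%N -> digits w -> 0 <= depth z ->
    (normc (cfden w z) ^+ 2)^-1 <= 4 / 3 * (3 / 4) ^+ size w.
  elim: n w => [|n IH] w.
    by rewrite leqn0 => /nilP-> _ _; rewrite /= normcC1 expr1n invr1 expr0; lra.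
  case: w => [|a [|b w]] /=.
  - by move=> _ _ _; rewrite normcC1 expr1n invr1 expr0; lra.
  - move=> _ /digits_cons[ha _] hz; rewrite mulr1.
    have h := normc_add_depth ha hz.
    rewrite expr1 (_ : 4 / 3 * (3 / 4) = 1 :> R); last by field.
    by rewrite invf_le1 ?exprn_ege1// exprn_gt0// (lt_le_trans ltr01).
  move=> sw /digits_cons[ha /digits_cons[hb hw]] hz.
  have hs := cfmap_depth hw hz.
  have h2 := cfden2 ha hb hs.
  rewrite mulrA normcM exprMn invfM.
  have -> : 4 / 3 * (3 / 4) ^+ (size w).+2 =
      9 / 16 * (4 / 3 * (3 / 4) ^+ size w) :> R by rewrite !exprS; field.
  rewrite ler_pM ?invr_ge0 ?sqr_ge0//.
    have -> : 9 / 16 = (16 / 9)^-1 :> R by field.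
    by rewrite lef_pV2 ?posrE; lra.
  by apply: IH => //; lia.
by move=> hw; apply: (key _ (size w)) => //; rewrite depth0.
Qed.

Lemma split_common_prefix u v : size u = size v -> u <> v ->
  exists p a b u' v', [/\ u = p ++ a :: u', v = p ++ b :: v' & a != b].
Proof.
elim: u v => [[]//|a u IH] [//|b v] /= [suv] uv.
have [eab|nab] := eqVneq a b; last by exists [::], a, b, u, v.
have [||p [c [d [u' [v' [-> -> cd]]]]]] := IH v => //.
  by move=> e; apply: uv; rewrite eab e.
by exists (a :: p), c, d, u', v'; rewrite eab.
Qed.

Lemma NplusZi_dist b c : NplusZi R b -> NplusZi R c -> b != c -> 1 <= normc (b - c).
Proof.
move=> [m [k [_ ->]]] [m' [k' [_ ->]]] hbc.
apply: normc_ge_sqr => //; rewrite expr1n sqr_normc_ReIm ReD ImD ReN ImN /=.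
rewrite -[m%:R]/(m%:Z%:~R) -[m'%:R]/(m'%:Z%:~R) -!rmorphB -!rmorphXn -rmorphD /=.
rewrite ler1z -gtz0_ge1 lt_neqAle addr_ge0 ?sqr_ge0// andbT eq_sym.
rewrite paddr_eq0 ?sqr_ge0// !sqrf_eq0 !subr_eq0; apply: contra hbc.
by move=> /andP[/eqP e /eqP ->]; apply/eqP; case: e => ->.
Qed.

(** Behind the common prefix the words differ in digits a and b with |a - b| >= 1. The tails s and
    s' lie in a disc of diameter 1, so a + s and b + s' could touch; that s is at least [depth s]
    away from the boundary keeps them that far apart. Inversion and the prefix then act with bounded
    distortion. *)
Lemma separation u v z z' : digits u -> digits v -> size u = size v -> u <> v ->
  0 <= depth z -> 0 <= depth z' ->
  weight u * depth z / 256 <= normc (cfmap u z - cfmap v z').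
Proof.
move=> hu hv suv uv hz hz'.
have [p [a [b [u' [v' [eu ev ab]]]]]] := split_common_prefix suv uv.
have [hp /digits_cons[ha hu']] : digits p /\ digits (a :: u').
  by apply/digits_cat; rewrite -eu.
have [_ /digits_cons[hb hv']] : digits p /\ digits (b :: v').
  by apply/digits_cat; rewrite -ev.
rewrite eu ev !cfmap_cat.
have hau : digits (a :: u') by apply/digits_cons.
have hbv : digits (b :: v') by apply/digits_cons.
apply: le_trans (cfmapB_ge hp (cfmap_depth hau hz) (cfmap_depth hbv hz')).
have /andP[_ w1] := weight_cat hp hau.
have wp := weight_gt0 hp.
have wau := weight_gt0 hau.
(* 256 = 36 * 4 * 16/9, with 4 from [cfmapB_ge] and 16/9 from [weight_cat]. The argument below
   yields even 1/8 in place of 1/36. *)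
suff : weight (a :: u') * depth z / 36 <=
    normc (cfmap (a :: u') z - cfmap (b :: v') z').
  move=> h; have : weight (p ++ a :: u') * depth z <=
    16 / 9 * (weight p * weight (a :: u')) * depth z by rewrite ler_wpM2r.
  by move: h; set X := normc _; set Y := weight (a :: u'); nra.
have dau := distortion hau hz.
have hs := cfmap_depth hu' hz; have hs' := cfmap_depth hv' hz'.
have ds := depth_cfmap hu' hz.
rewrite /= in dau *.
set s := cfmap u' z in dau hs ds *; set s' := cfmap v' z' in hs' *.
have A1 := normc_add_depth ha hs; have B1 := normc_add_depth hb hs'.
set tau := depth z / normc (cfden u' z) ^+ 2 in ds.
have N1 := normc_cfden_ge1 hu' hz.
have tau0 : 0 <= tau by rewrite divr_ge0 ?sqr_ge0.
have tau1 : tau <= 1.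
  by apply: le_trans ds _; rewrite depthE; have := sqr_ge0 (normc (s - (2^-1)%:C)); lra.
have AB : tau <= normc ((a + s) - (b + s')).
  have := NplusZi_dist ha hb ab.
  have -> : a - b = (a + s - (b + s')) - ((s - (2^-1)%:C) - (s' - (2^-1)%:C)) by ring.
  move/le_trans => /(_ _ (le_normcD _ _)); rewrite normcN => h.
  have := le_normcD (s - (2^-1)%:C) (- (s' - (2^-1)%:C)); rewrite normcN => h'.
  have := dist_half hs; have := dist_half hs'; lra.
have A0 : a + s != 0 by rewrite -normc_gt0; lra.
have B0 : b + s' != 0 by rewrite -normc_gt0; lra.
have -> : (a + s)^-1 - (b + s')^-1 = ((b + s') - (a + s)) / ((a + s) * (b + s')).
  by field; rewrite A0 B0.
rewrite normcM normcV normcM normc_distC.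
have BA : normc (b + s') <= normc (a + s) + normc ((a + s) - (b + s')).
  have {1}-> : b + s' = (a + s) - ((a + s) - (b + s')) by ring.
  by rewrite (le_trans (le_normcD _ _))// normcN.
have /andP[dau1 _] := dau.
rewrite normcM exprMn invfM in dau1.
set A : R := normc (a + s) in A1 BA dau1 *; set B : R := normc (b + s') in B1 BA *.
set d : R := normc (a + s - (b + s')) in AB BA *.
(* [B] may be much larger than [A], but only if [d] is large too: use B <= A + d together with tau
   <= d, tau <= 1 and 1 <= A. *)
have step : tau / (2 * A ^+ 2) <= d / (A * B).
  rewrite ler_pdivrMr; last by rewrite mulr_gt0// exprn_gt0//; lra.
  rewrite mulrAC ler_pdivlMr; last by rewrite mulr_gt0//; lra.
  have d0 : 0 <= d by exact: le_trans AB.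
  have A0' : 0 <= A by exact: le_trans A1.
  have e1 : tau * A * B <= tau * A * (A + d) by rewrite ler_wpM2l// mulr_ge0.
  have e2 : tau * (A * A) <= d * (A * A) by rewrite ler_wpM2r// mulr_ge0.
  have e3 : tau * (A * d) <= 1 * (A * d) by rewrite ler_wpM2r// mulr_ge0.
  have e4 : A * d * 1 <= A * d * A by rewrite ler_wpM2l// mulr_ge0.
  by lra.
apply: le_trans step.
have -> : tau / (2 * A ^+ 2) = depth z * (A ^- 2 * normc (cfden u' z) ^- 2) / 2.
  by rewrite /tau; field; apply/andP; split; rewrite gt_eqF//; lra.
by nra.
Qed.

End ContinuedFractionMaps.

(** * Values of infinite continued fractions *)

Section Limits.
Variable R : realType.
Implicit Types (z : R[i]) (w : seq R[i]) (b : nat -> R[i]).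

Lemma geometric_small (C q e : R) : 0 <= q < 1 -> 0 < e ->
  exists N, forall n, (N <= n)%N -> C * q ^+ n < e.
Proof.
move=> /andP[q0 q1] e0.
have : C *: (q ^+ n) @[n --> \oo] --> C *: (0 : R).
  by apply: cvgZr; apply: cvg_expr; rewrite ger0_norm.
rewrite scaler0 => /cvgrPdist_lt /(_ e e0) [N _ h].
exists N => n /h /=; rewrite sub0r normrN => {}h.
by apply: le_lt_trans h; exact: ler_norm.
Qed.

Lemma le0_geometric (x C q : R) : 0 <= q < 1 -> (forall n, x <= C * q ^+ n) -> x <= 0.
Proof.
move=> q01 h; rewrite leNgt; apply/negP => x0.
have [N hN] := geometric_small C q01 x0.
by have := lt_le_trans (hN N (leqnn N)) (h N); rewrite ltxx.
Qed.

(** Nested intervals: the limit is the supremum of the lower ends u n - C q^n. *)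
Lemma geometric_limit_real (u : nat -> R) (C q : R) : 0 <= q < 1 -> 0 <= C ->
  (forall n m, (n <= m)%N -> `|u m - u n| <= C * q ^+ n) ->
  exists l, forall n, `|u n - l| <= C * q ^+ n.
Proof.
move=> /andP[q0 q1] C0 h.
have key n m : u n - C * q ^+ n <= u m + C * q ^+ m.
  have pos k : 0 <= C * q ^+ k by rewrite mulr_ge0 ?exprn_ge0.
  have := pos n; have := pos m.
  by have [/h|/ltnW/h] := leqP n m; rewrite ler_norml => /andP[]; lra.
pose A := [set x | exists n, x = u n - C * q ^+ n].
have A0 : A !=set0 by exists (u 0%N - C * q ^+ 0); exists 0%N.
have ubA m : ubound A (u m + C * q ^+ m) by move=> _ [n ->]; exact: key.
exists (sup A) => n; rewrite ler_norml; apply/andP; split.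
- by have := ge_sup A0 (ubA n); lra.
- have : has_sup A by split=> //; exists (u 0%N + C * q ^+ 0); exact: ubA.
  move/sup_upper_bound/(_ (u n - C * q ^+ n)) => /(_ (ex_intro _ n erefl)); lra.
Qed.

Lemma geometric_limit (u : nat -> R[i]) (C q : R) : 0 <= q < 1 -> 0 <= C ->
  (forall n m, (n <= m)%N -> normc (u m - u n) <= C * q ^+ n) ->
  exists l, forall n, normc (u n - l) <= 2 * C * q ^+ n.
Proof.
move=> q01 C0 h.
have [|||a ha] := @geometric_limit_real (fun n => complex.Re (u n)) C q => //.
  move=> n m nm; apply: le_trans (h _ _ nm); rewrite -ReN -ReD.
  exact: Re_le_normc.
have [|||c hc] := @geometric_limit_real (fun n => complex.Im (u n)) C q => //.
  move=> n m nm; apply: le_trans (h _ _ nm); rewrite -ImN -ImD.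
  exact: Im_le_normc.
exists (a +i* c) => n; apply: le_trans (normc_le_ReIm _) _.
by rewrite ReD ImD ReN ImN /=; have := ha n; have := hc n; lra.
Qed.

Lemma mkseq_cons (T : Type) (b : nat -> T) n :
  mkseq b n.+1 = b 0%N :: mkseq (fun k => b k.+1) n.
Proof. by rewrite /mkseq /= (iotaDl 1 0) -map_comp. Qed.

Lemma mkseq_add (T : Type) (b : nat -> T) n m :
  mkseq b (n + m) = mkseq b n ++ mkseq (fun k => b (n + k)%N) m.
Proof.
rewrite /mkseq iotaD map_cat; congr (_ ++ _).
by rewrite add0n -{1}[n]addn0 iotaDl -map_comp.
Qed.

Lemma convergentE b n : convergent b n = cfmap (mkseq b n) 0.
Proof. by elim: n b => // n IH b; rewrite mkseq_cons /= IH. Qed.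

Lemma digits_mkseq b n : (forall n, NplusZi R (b n)) -> digits (mkseq b n).
Proof. by move=> h c /mapP[k _ ->]; exact: h. Qed.

(** Convergence with an explicit rate, so that uniqueness, shifts and membership in the disc become
    inequalities. The constant 6 is twice the 3 of [cfmap_geometric], doubled by
    [geometric_limit]. *)
Definition cfvalue b z := forall n, normc (cfmap (mkseq b n) 0 - z) <= 6 * (3 / 4) ^+ n.

Let q01 : 0 <= (3 / 4 : R) < 1. Proof. by apply/andP; split; lra. Qed.

Let depth00 : 0 <= depth (0 : R[i]). Proof. by rewrite depth0. Qed.

Lemma depth_dist1 z z' : 0 <= depth z -> 0 <= depth z' -> normc (z - z') <= 1.
Proof.
move=> h h'; have := dist_half h; have := dist_half h'.
by have := normc_triangle (2^-1)%:C z z'; rewrite [normc ((2^-1)%:C - z')]normc_distC; lra.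
Qed.

Lemma cfmap_geometric w z z' : digits w -> 0 <= depth z -> 0 <= depth z' ->
  normc (cfmap w z - cfmap w z') <= 3 * (3 / 4) ^+ size w.
Proof.
move=> hw hz hz'; apply: le_trans (cfmapB_le hw hz hz') _.
have := weight_decay hw; have := depth_dist1 hz hz'; have := weight_gt0 hw.
have := normc_ge0 (z - z'); nra.
Qed.

Lemma cfvalue_exists b : (forall n, NplusZi R (b n)) -> exists z, cfvalue b z.
Proof.
move=> hb.
have [|||z hz] := @geometric_limit (fun n => cfmap (mkseq b n) 0) 3 (3 / 4) => //.
  move=> n m /subnKC <-; rewrite mkseq_add cfmap_cat -[n in _ ^+ n](size_mkseq b).
  apply: cfmap_geometric => //; first exact: digits_mkseq.
  by apply: cfmap_depth => //; apply: digits_mkseq.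
by exists z => n; have := hz n; rewrite -natrM.
Qed.

Lemma cfvalue_unique b z z' : cfvalue b z -> cfvalue b z' -> z = z'.
Proof.
move=> h h'; apply/eqP; rewrite -subr_eq0 -[_ == _]negbK -normc_gt0 -leNgt.
apply: (@le0_geometric _ 12 (3 / 4)) => // n.
rewrite (le_trans (normc_triangle (cfmap (mkseq b n) 0) _ _))// normc_distC.
by have := h n; have := h' n; lra.
Qed.

Lemma cfvalue_depth b z : (forall n, NplusZi R (b n)) -> cfvalue b z -> 0 <= depth z.
Proof.
move=> hb hz.
have : normc (z - (2^-1)%:C) <= 2^-1.
  rewrite -subr_le0; apply: (@le0_geometric _ 6 (3 / 4)) => // n.
  have := normc_triangle (cfmap (mkseq b n) 0) z (2^-1)%:C.
  have hd := cfmap_depth (digits_mkseq (n := n) hb) depth00.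
  by have := dist_half hd; rewrite [normc (z - cfmap _ _)]normc_distC; have := hz n; lra.
rewrite depthE; have := normc_ge0 (z - (2^-1)%:C); move: (normc _) => t; nra.
Qed.

Lemma cfvalue_shift b z n : (forall n, NplusZi R (b n)) -> cfvalue b z ->
  exists2 z', cfvalue (fun k => b (n + k)%N) z' & z = cfmap (mkseq b n) z'.
Proof.
move=> hb hz; have hb' k : NplusZi R (b (n + k)%N) by [].
have [z' hz'] := cfvalue_exists hb'; exists z' => //.
apply/eqP; rewrite -subr_eq0 -[_ == _]negbK -normc_gt0 -leNgt.
apply: (@le0_geometric _ 18 (3 / 4)) => // m.
rewrite (le_trans (normc_triangle (cfmap (mkseq b (n + m)) 0) _ _))// normc_distC.
have hm := hz (n + m)%N.
have hmn : 6 * (3 / 4 : R) ^+ (n + m) <= 6 * (3 / 4) ^+ m.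
  by case/andP: q01 => q0 q1; rewrite ler_pM2l// ler_wiXn2l ?leq_addl// ltW.
have hdm := digits_mkseq (n := m) hb'; have hdn := digits_mkseq (n := n) hb.
have h1 := cfmap_depth hdm depth00.
have := cfmapB_le hdn h1 (cfvalue_depth hb' hz').
rewrite -cfmap_cat -mkseq_add => h2; have h3 := hz' m.
have := weight_le1 hdn; have := weight_gt0 hdn.
move: hm hmn h2 h3; set X : R := normc _; set Y : R := normc _.
set Z : R := normc _; set W : R := weight _.
move=> hm hmn h2 h3 W0 W1.
have Z0 : 0 <= Z by exact: normc_ge0.
have : W * Z <= 1 * Z by rewrite ler_wpM2r.
by lra.
Qed.

Lemma F_NplusZiP z : F_NplusZi R z <->
  exists2 b, (forall n, NplusZi R (b n)) & cfvalue b z.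
Proof.
have fwd b z' : cfvalue b z' -> convergent b n @[n --> \oo] --> z'.
  move=> hz'; apply/cvg_ballP => e.
  rewrite ltcE /= => /andP[/eqP e1 e0].
  have {e1} -> : e = (complex.Re e)%:C by case: e e1 {e0} => /= a c ->.
  have [N hN] := geometric_small 6 q01 e0.
  exists N => // n /= /hN nN; apply/ballC; rewrite normc_distC convergentE.
  by apply: le_lt_trans nN; exact: hz'.
split=> [[b [hb hz]]|[b hb hz]]; last by exists b; split=> //; exact: fwd.
have [z' hz'] := cfvalue_exists hb; exists b => //.
suff -> : z = z' by [].
apply: (@cvg_unique _ (@norm_hausdorff _ _) _ _ _ _ hz (fwd _ _ hz')).
Qed.

Lemma F_NplusZi_depth z : F_NplusZi R z -> 0 <= depth z.
Proof. by move=> /F_NplusZiP[b hb hz]; exact: cfvalue_depth hz. Qed.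

Lemma F_NplusZi_cfmap w z : digits w -> F_NplusZi R z -> F_NplusZi R (cfmap w z).
Proof.
move=> hw /F_NplusZiP[b hb hz].
pose b' k := if (k < size w)%N then nth 0 w k else b (k - size w)%N.
have hb' k : NplusZi R (b' k).
  by rewrite /b'; case: ifPn => // kw; apply: hw; exact: mem_nth.
have [z' hz'] := cfvalue_exists hb'.
have [y hy e] := cfvalue_shift (size w) hb' hz'.
have eb : (fun k => b' (size w + k)%N) = b.
  by apply/funext => k; rewrite /b' ltnNge leq_addr /= addKn.
rewrite eb in hy; rewrite (cfvalue_unique hz hy).
have -> : cfmap w y = z'.
  rewrite e; congr cfmap; apply: (@eq_from_nth _ 0); rewrite ?size_mkseq// => i iw.
  by rewrite nth_mkseq// /b' iw.
by apply/F_NplusZiP; exists b'.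
Qed.

Lemma F_NplusZi_nonempty : exists z, F_NplusZi R z.
Proof.
have h1 (n : nat) : NplusZi R 1.
  by exists 1%N, 0; split=> //; rewrite -[in RHS]complexr0.
have [z hz] := cfvalue_exists h1.
by exists z; apply/F_NplusZiP; exists (fun=> 1).
Qed.

End Limits.

(** * Finite sums grouped by level or by dyadic size *)

Section FiniteSums.
Variable R : realType.

Lemma sum_group (T G : eqType) (W : seq T) (U : seq G) (h : T -> G) (f : T -> R) :
  uniq U -> {in W, forall i, h i \in U} ->
  \sum_(i <- W) f i = \sum_(g <- U) \sum_(i <- W | h i == g) f i.
Proof.
move=> uU hU; rewrite (exchange_big_dep xpredT)//= !big_seq; apply: eq_bigr => i iW.
rewrite big_const_seq (eq_count (a2 := pred1 (h i))); last first.
  by move=> g /=; rewrite eq_sym.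
by rewrite count_uniq_mem// hU//= addr0.
Qed.

Lemma sum_group_undup (T G : eqType) (W : seq T) (h : T -> G) (f : T -> R) :
  \sum_(i <- W) f i = \sum_(g <- undup (map h W)) \sum_(i <- W | h i == g) f i.
Proof.
by apply: sum_group => [|i iW]; rewrite ?undup_uniq// mem_undup map_f.
Qed.

Lemma sum_geometric_le (T : eqType) (W : seq T) (h : T -> nat) (f : T -> R) (B q : R) :
  0 <= q < 1 -> 0 <= B ->
  (forall n, \sum_(i <- W | h i == n) f i <= B * q ^+ n) ->
  \sum_(i <- W) f i <= B / (1 - q).
Proof.
move=> /andP[q0 q1] B0 hB; pose N := (\max_(i <- W) h i).+1.
rewrite (@sum_group _ _ W (iota 0 N) h f) ?iota_uniq//; last first.
  by move=> i iW; rewrite mem_iota /= add0n ltnS leq_bigmax_seq.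
apply: (@le_trans _ _ (\sum_(g <- iota 0 N) B * q ^+ g)).
  by apply: ler_sum => n _; exact: hB.
rewrite -mulr_sumr ler_wpM2l// -[N]subn0 -/(index_iota 0 N) big_mkord.
have := subrX1 q N; have : 0 <= q ^+ N by rewrite exprn_ge0.
rewrite -div1r ler_pdivlMr ?subr_gt0//; set S := \sum_(_ < _) _.
by move=> h1 h2; have -> : S * (1 - q) = - ((q - 1) * S); [ring | rewrite -h2; lra].
Qed.

Lemma powR_exprn (a r : R) n : 0 <= a -> (a ^+ n) `^ r = (a `^ r) ^+ n.
Proof.
by move=> a0; rewrite -powR_mulrn// -powRrM mulrC powRrM powR_mulrn// powR_ge0.
Qed.

Lemma powR_lt1 (a r : R) : 0 <= a < 1 -> 0 < r -> a `^ r < 1.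
Proof.
move=> /andP[a0 a1] r0; have <- : 1 `^ r = 1 :> R by rewrite powR1.
by apply: gt0_ltr_powR; rewrite ?nnegrE.
Qed.

Lemma powR_le_half (a d s : R) : 0 < d -> d / 2 <= a <= d -> a `^ s <= 2 `^ `|s| * d `^ s.
Proof.
move=> d0 /andP[h1 h2]; have a0 : 0 < a by lra.
have [s0|s0] := leP 0 s.
  apply: le_trans (_ : d `^ s <= _).
    by apply: ge0_ler_powR; rewrite ?nnegrE// ltW.
  rewrite ler_peMl ?powR_ge0// -[leLHS](powRr0 2) ler_powR// ler1n//.
have ns : 0 <= - s by rewrite oppr_ge0 ltW.
rewrite -[s in a `^ s]opprK -[s in d `^ s]opprK !(powRN _ (- s)) ltr0_norm//.
rewrite -lef_pV2 ?posrE ?mulr_gt0 ?invr_gt0 ?powR_gt0// invfM !invrK.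
rewrite mulrC ler_pdivrMr ?powR_gt0// -powRM ?(ltW a0)//.
by apply: ge0_ler_powR; rewrite ?nnegrE ?mulr_ge0 ?(ltW a0) ?(ltW d0)//; lra.
Qed.

(* The exponents may be negative: this serves both for weights bounded above
   and, through their inverses, for weights bounded below. *)
Lemma sum_dyadic_le (T : eqType) (W : seq T) (a : T -> R) (s p P d1 : R) :
  p < s -> 0 <= P -> 0 < d1 -> {in W, forall i, 0 < a i <= d1} ->
  (forall d : R, 0 < d <= d1 ->
     (size [seq i <- W | d / 2 <= a i <= d])%:R <= P * d `^ (- p)) ->
  \sum_(i <- W) a i `^ s <=
    2 `^ `|s| * (P * d1 `^ (s - p)) / (1 - 2^-1 `^ (s - p)).
Proof.
move=> ps P0 d10 aW hP.
have half01 : 0 <= (2^-1 : R) < 1 by apply/andP; split; lra.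
have sp0 : 0 < s - p by lra.
have dpos k : 0 < d1 * 2^-1 ^+ k by rewrite mulr_gt0// exprn_gt0.
have dle k : d1 * 2^-1 ^+ k <= d1.
  case/andP: half01 => q0 q1; rewrite -[leRHS]mulr1 ler_wpM2l ?(ltW d10)//.
  by rewrite exprn_ile1// (ltW q1).
have /choice[h hh] : forall i, exists k : nat, i \in W ->
    d1 * 2^-1 ^+ k / 2 <= a i <= d1 * 2^-1 ^+ k.
  move=> i; have [iW|] := boolP (i \in W); last by exists 0%N.
  have /andP[a0 a1] := aW _ iW.
  have ex : exists k : nat, d1 * 2^-1 ^+ k / 2 < a i.
    have [N hN] := geometric_small d1 half01 a0.
    by exists N; have := hN N (leqnn N); have := dpos N; lra.
  case: (ex_minnP ex) => [[|k]] hk kmin.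
    by exists 0%N => _; rewrite (ltW hk) /= expr0 mulr1.
  exists k.+1 => _; rewrite (ltW hk) /= exprS.
  have : ~~ (d1 * 2^-1 ^+ k / 2 < a i) by apply/negP => /kmin; rewrite ltnn.
  by rewrite -leNgt; lra.
apply: (@sum_geometric_le _ W h).
- by rewrite powR_ge0 powR_lt1.
- by rewrite !mulr_ge0 ?powR_ge0.
move=> n; set d : R := d1 * 2^-1 ^+ n.
apply: (@le_trans _ _ (\sum_(i <- W | d / 2 <= a i <= d) 2 `^ `|s| * d `^ s)).
  rewrite big_seq_cond [leRHS]big_mkcond /= [leRHS]big_seq [leLHS]big_mkcond /=.
  rewrite [leRHS]big_mkcond /=; apply: ler_sum => i _.
  case: ifPn => [/andP[iW /eqP hn]|_]; last first.
    by case: ifP => // _; case: ifP => // _; rewrite mulr_ge0 ?powR_ge0.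
  have := hh _ iW; rewrite hn -/d => hd; rewrite iW hd.
  exact: powR_le_half (dpos n) hd.
rewrite -big_filter big_const_seq count_predT iter_addr_0 -[_ *+ size _]mulr_natl.
have /hP hc : 0 < d <= d1 by rewrite dpos dle.
apply: le_trans (_ : P * d `^ (- p) * (2 `^ `|s| * d `^ s) <= _).
  by rewrite ler_wpM2r// mulr_ge0 ?powR_ge0.
have -> : P * d `^ (- p) * (2 `^ `|s| * d `^ s) = 2 `^ `|s| * (P * d `^ (s - p)).
  rewrite addrC powRD; last by rewrite (gt_eqF (dpos n)) implybT.
  by ring.
case/andP: half01 => q0 q1.
by rewrite /d powRM ?exprn_ge0 ?(ltW d10)// powR_exprn// !mulrA lexx.
Qed.

End FiniteSums.

(** * Separated sets, nets and covering numbers *)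

Section Packing.
Variable R : realType.
Implicit Types (x y : R[i]) (E : set R[i]).

Definition is_separated (T : eqType) (f : T -> R[i]) (d : R) (s : seq T) :=
  {in s &, forall i j, i != j -> d <= normc (f i - f j)}.

(** A grid of mesh d/2 has at most one point per cell, since two points in one cell are less than
    d/2 + d/2 apart. Each side of the square around y meets at most 4 rho / d + 1 cells. *)
Lemma separated_size (T : eqType) (f : T -> R[i]) (d rho : R) (s : seq T) y :
  uniq s -> 0 < d -> 0 <= rho -> is_separated f d s ->
  {in s, forall i, normc (f i - y) <= rho} ->
  (size s)%:R <= 16 * (1 + rho / d) ^+ 2.
Proof.
move=> us d0 rho0 sep hs.
pose cell t : nat := Num.truncn ((t + rho) * (2 / d)).
have e0 : 0 < 2 / d by rewrite divr_gt0.
pose N := (Num.truncn (4 * rho / d)).+1.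
have cellP t t' : 0 <= t + rho -> 0 <= t' + rho -> cell t = cell t' ->
    `|t - t'| < d / 2.
  move=> h h' e.
  have /andP[h1 h2] := truncn_itv (mulr_ge0 h (ltW e0)).
  have /andP[h3 h4] := truncn_itv (mulr_ge0 h' (ltW e0)).
  move: e; rewrite /cell => e; rewrite e in h1 h2.
  rewrite -[(Num.truncn _).+1%:R]natr1 in h2; rewrite -[(Num.truncn _).+1%:R]natr1 in h4.
  move: h1 h2 h3 h4; move: (Num.truncn _)%:R => m h1 h2 h3 h4.
  have k : `|(t - t') * (2 / d)| < 1 by rewrite ltr_norml; apply/andP; split; lra.
  rewrite normrM [X in _ * X]gtr0_norm// -ltr_pdivlMr// in k.
  by rewrite (lt_le_trans k)// le_eqVlt; apply/orP; left; apply/eqP; field; rewrite gt_eqF.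
have ReIm i : i \in s -> 0 <= complex.Re (f i - y) + rho <= 2 * rho /\
    0 <= complex.Im (f i - y) + rho <= 2 * rho.
  move=> /hs h; have := le_trans (Re_le_normc _) h; have := le_trans (Im_le_normc _) h.
  by rewrite !ler_norml => /andP[h1 h2] /andP[h3 h4]; split; apply/andP; split; lra.
have cellN t : 0 <= t + rho <= 2 * rho -> cell t \in iota 0 N.
  move=> /andP[h1 h2]; rewrite mem_iota add0n /= ltnS; apply: le_truncn.
  have -> : 4 * rho / d = 2 * rho * (2 / d) by ring.
  by rewrite ler_pM2r.
pose F i := (cell (complex.Re (f i - y)), cell (complex.Im (f i - y))).
have injF : {in s &, injective F}.
  move=> i j si sj [eR eI]; apply/eqP; apply: contraT => ij.
  have [/andP[r1 _] /andP[i1 _]] := ReIm _ si; have [/andP[r2 _] /andP[i2 _]] := ReIm _ sj.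
  have kR := cellP _ _ r1 r2 eR; have kI := cellP _ _ i1 i2 eI.
  have := sep _ _ si sj ij; rewrite leNgt (le_lt_trans (normc_le_ReIm _))//.
  move: kR kI; have -> : f i - f j = (f i - y) - (f j - y) by ring.
  by rewrite [complex.Re (_ - (_ - _))]ReD [complex.Im (_ - (_ - _))]ImD ReN ImN; lra.
have sz : (size s <= N * N)%N.
  rewrite -(size_map F) -[X in (_ <= X * X)%N](size_iota 0 N) -(size_allpairs pair).
  apply: uniq_leq_size; first by rewrite map_inj_in_uniq.
  move=> _ /mapP[i si ->]; have [h1 h2] := ReIm _ si.
  by apply: allpairs_f; exact: cellN.
apply: le_trans (_ : (N * N)%:R <= _); first by rewrite ler_nat.
rewrite natrM /N.
have r0 : 0 <= 4 * rho / d by rewrite divr_ge0// ?mulr_ge0// ltW.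
have /andP[h1 _] := truncn_itv r0; rewrite -natr1.
move: h1; rewrite -mulrA; have : 0 <= rho / d by rewrite divr_ge0// ltW.
have : 0 <= (Num.truncn (4 * (rho / d)))%:R :> R by [].
move: (Num.truncn _)%:R => m; move: (rho / d) => t; nra.
Qed.

Lemma exists_longest (T : Type) (P : seq T -> Prop) (N : nat) : P [::] ->
  (forall s, P s -> (size s <= N)%N) ->
  exists2 s, P s & forall s', P s' -> (size s' <= size s)%N.
Proof.
move=> P0 hN; pose Q n := `[< exists2 s, P s & size s = n >].
have exQ : exists n, Q n by exists 0%N; apply/asboolP; exists [::].
have ubQ n : Q n -> (n <= N)%N by move=> /asboolP[s Ps <-]; exact: hN.
case: (ex_maxnP exQ ubQ) => m /asboolP[s Ps sm] hm; exists s => // s' Ps'.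
by rewrite sm; apply: hm; apply/asboolP; exists s'.
Qed.

(** A longest d-separated list in E is a net; [separated_size] bounds the lengths, so that a longest
    one exists. *)
Lemma exists_net E (d rho : R) y : 0 < d -> 0 <= rho ->
  (forall x, E x -> normc (x - y) <= rho) ->
  exists s : seq R[i], [/\ uniq s, {in s, forall x, E x}, is_separated id d s &
    forall x, E x -> exists2 c, c \in s & normc (x - c) < d].
Proof.
move=> d0 rho0 hE.
pose P (s : seq R[i]) := [/\ uniq s, {in s, forall x, E x} & is_separated id d s].
have [||s [us Es ss] smax] := @exists_longest _ P (Num.truncn (16 * (1 + rho / d) ^+ 2 : R)).
- by split.
- move=> s [us Es ss].
  have h := separated_size us d0 rho0 ss (fun i si => hE _ (Es _ si)).
  by rewrite truncn_ge_nat// mulr_ge0// sqr_ge0.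
exists s; split=> // x Ex; apply: contrapT => nx.
have far c : c \in s -> d <= normc (x - c).
  by move=> cs; rewrite leNgt; apply/negP => h; apply: nx; exists c.
suff : P (x :: s) by move/smax; rewrite ltnn.
split=> /=.
- rewrite us andbT; apply/negP => /far; rewrite subrr normc0.
  by rewrite leNgt d0.
- by move=> c; rewrite inE => /orP[/eqP->|/Es].
- move=> a c; rewrite !inE => /orP[/eqP->|sa] /orP[/eqP->|sc]; rewrite ?eqxx//.
  + by move=> _; exact: far.
  + by move=> _; rewrite normc_distC; exact: far.
  + by move=> ac; exact: ss.
Qed.

Lemma covering_number_le (r : R) E (s : seq R[i]) :
  (forall x, E x -> exists2 c, c \in s & normc (x - c) < r) ->
  (covering_number r E <= (size s)%:R%:E)%E.
Proof.
move=> h; apply: ereal_inf_lbound; exists (size s) => //.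
exists (tnth (in_tuple s)) => x /h[c cs xc].
have /tnthP[i ci] : c \in in_tuple s by [].
by exists i => //; apply/ballC; rewrite -ci normc_distC.
Qed.

Lemma covering_number_ge (r : R) E (T : eqType) (f : T -> R[i]) (s : seq T) :
  uniq s -> {in s, forall i, E (f i)} -> is_separated f (2 * r) s ->
  ((size s)%:R%:E <= covering_number r E)%E.
Proof.
move=> us Es ss; apply/ereal_infP => _ [n [c hc] <-]; rewrite lee_fin ler_nat.
have /choice[g hg] : forall i : 'I_(size s), exists k : 'I_n,
    ball (c k) r%:C (f (tnth (in_tuple s) i)).
  by move=> i; have [k _ hk] := hc _ (Es _ (mem_tnth i (in_tuple s))); exists k.
have gI : injective g.
  move=> i j e; have := hg i; have := hg j; rewrite -e => /ballC hj /ballC hi.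
  apply/eqP; apply: contraT => ij.
  have := ss _ _ (mem_tnth i (in_tuple s)) (mem_tnth j (in_tuple s)).
  rewrite (inj_eq (@tuple_uniqP _ _ (in_tuple s) us))//= => /(_ ij); rewrite leNgt.
  rewrite (le_lt_trans (normc_triangle (c (g i)) _ _))//.
  by move: hi; rewrite normc_distC; lra.
by have := leq_card g gI; rewrite !card_ord.
Qed.

End Packing.

(** * Large weight sums force positive Hausdorff measure *)

Section HausdorffLowerBound.
Variable R : realType.
Implicit Types (z : R[i]) (w u v : seq R[i]).

Lemma powRV (a r : R) : 0 <= a -> a^-1 `^ r = (a `^ r)^-1.
Proof. by move=> a0; rewrite -powR_inv1// -powRrM mulN1r powRN. Qed.

(** Consecutive intervals of lengths [p i] fill [0, sum p), with [a i] the left end of the interval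
    of i. Iterating this yields the expansion of t in blocks. *)
Lemma exists_subdivision (T : eqType) (W : seq T) (p : T -> R) : uniq W ->
  {in W, forall i, 0 < p i} ->
  exists a : T -> R, forall t : R, 0 <= t < \sum_(i <- W) p i ->
    exists2 i, i \in W & exists2 t' : R, 0 <= t' < 1 & t = a i + p i * t'.
Proof.
elim: W => [_ _|w0 W IH /= /andP[w0W uW] pW].
  by exists (fun=> 0) => t; rewrite big_nil => /andP[]; lra.
have [|a ha] := IH uW; first by move=> w wW; apply: pW; rewrite inE wW orbT.
have p0 : 0 < p w0 by apply: pW; rewrite mem_head.
exists (fun i => if i == w0 then 0 else p w0 + a i) => t; rewrite big_cons.
move=> /andP[t0 t1]; have [h|h] := ltP t (p w0).
  exists w0; rewrite ?mem_head//; exists (t / p w0).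
    by rewrite divr_ge0 ?(ltW p0)//= ltr_pdivrMr// mul1r.
  by rewrite eqxx add0r mulrC divfK// gt_eqF.
have [|w wW [t' t'01 e]] := ha (t - p w0); first by apply/andP; split; lra.
exists w; first by rewrite inE wW orbT.
exists t' => //; case: eqP => [ew|_]; last by rewrite -addrA -e; ring.
by move: w0W; rewrite -ew wW.
Qed.

Lemma exists_lower_bound (T : eqType) (W : seq T) (p : T -> R) :
  {in W, forall i, 0 < p i} -> exists2 m : R, 0 < m & {in W, forall i, m <= p i}.
Proof.
elim: W => [_|w0 W IH pW]; first by exists 1.
have [|m m0 hm] := IH; first by move=> w wW; apply: pW; rewrite inE wW orbT.
have p0 : 0 < p w0 by apply: pW; rewrite mem_head.
exists (Num.min m (p w0)); first by rewrite lt_min m0.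
by move=> w; rewrite inE ge_min => /orP[/eqP->|/hm ->//]; rewrite lexx orbT.
Qed.

Definition digit2 : R[i] := 2%:R +i* 0.

Lemma NplusZi_digit2 : NplusZi R digit2.
Proof. by exists 2%N, 0. Qed.

Lemma digits_digit2 : digits [:: digit2].
Proof. by apply/digits_cons; split=> //; exact: NplusZi_digit2. Qed.

Lemma weight_digit2 : weight [:: digit2] = 4^-1.
Proof.
rewrite /weight /= addr0 mulr1 sqr_normc_ReIm /=; congr _^-1; ring.
Qed.

(** For v = 2 + z, the depth (Re v - 1) / |v|^2 of 1/v has numerator at least 1 and denominator at
    most 9. *)
Lemma depth_cfmap_digit2 z : 0 <= depth z -> 9^-1 <= depth (cfmap [:: digit2] z).
Proof.
move=> hz /=; have hR := Re_depth hz.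
rewrite depth_inv ReD /=; last by lra.
have h1 := normc_add_depth NplusZi_digit2 hz.
have h3 : normc (digit2 + z) <= 3.
  rewrite (le_trans (le_normcD _ _))//; have := normc_depth hz.
  have : normc digit2 <= 2.
    by apply: normc_le_sqr => //; rewrite sqr_normc_ReIm /= expr0n /= addr0.
  lra.
rewrite ler_pdivlMr; last by rewrite exprn_gt0//; lra.
have : normc (digit2 + z) ^+ 2 <= 3 ^+ 2 by rewrite ler_sqr ?nnegrE//; lra.
lra.
Qed.

(** 64 = 4^3: two concatenations, and the weight 1/4 of the digit 2. *)
Lemma weight_cat_digit2 u w : digits u -> digits w ->
  weight u * weight w / 64 <= weight (u ++ rcons w digit2).
Proof.
move=> hu hw; have hw2 : digits (rcons w digit2).
  by apply/digits_rcons; split=> //; exact: NplusZi_digit2.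
have /andP[h1 _] := weight_cat hu hw2.
have /andP[h2 _] := weight_cat hw digits_digit2.
rewrite cats1 weight_digit2 in h2; have := weight_gt0 hu.
by move: h1 h2; set X := weight u; set Y := weight w; set Z := weight (rcons _ _); nra.
Qed.

(* The digit 2 maps the disc strictly inside itself. Appending it to the words of
   [W] thus gives pieces that are separated in proportion to their sizes, as
   [separation] requires a point of positive depth, and the coding [g] of these
   pieces by the numbers of [0, 1) has a Hoelder inverse. *)
Lemma cf_coding (s : R) (n : nat) (W : seq (seq R[i])) : 0 <= s ->
  uniq W -> {in W, forall w, digits w /\ size w = n} ->
  2 * 64 `^ s <= \sum_(w <- W) weight w `^ s ->
  exists (g : R -> R[i]) (C : R), [/\ 0 <= C,
    forall t : R, 0 <= t < 1 -> F_NplusZi R (g t) &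
    forall t t' : R, 0 <= t < 1 -> 0 <= t' < 1 ->
      `|t - t'| <= C * normc (g t - g t') `^ s].
Proof.
move=> s0 uW hW; set Z := \sum_(w <- W) _ => hZ.
have k1 : 1 <= 64 `^ s :> R by rewrite -[leLHS](powRr0 64) ler_powR// ler1n.
have Z0 : 0 < Z by lra.
have wpos w : w \in W -> 0 < weight w by move=> /hW[hw _]; exact: weight_gt0.
(* The two factors of 2 * 64^s serve different ends: 2 makes every p at most 1/2, so that the coding
   intervals shrink, and 64^s pays for the loss in [weight_cat_digit2]. *)
pose p w := weight w `^ s / Z.
have pW : {in W, forall w, 0 < p w} by move=> w wW; rewrite divr_gt0// powR_gt0// wpos.
have p2 w : w \in W -> p w <= 2^-1.
  move=> wW; rewrite ler_pdivrMr//; apply: (@le_trans _ _ 1); last by lra.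
  have [hw _] := hW _ wW.
  have <- : 1 `^ s = 1 :> R by rewrite powR1.
  by apply: ge0_ler_powR; rewrite ?nnegrE// ?weight_le1// ltW// weight_gt0.
have [m m0 hm] := exists_lower_bound (fun w wW => wpos w wW).
have [a ha] := exists_subdivision uW pW.
have sp : \sum_(w <- W) p w = 1 by rewrite -mulr_suml divff// gt_eqF.
rewrite sp in ha.
have /choice[f hf] : forall t : R, exists x : seq R[i] * R, 0 <= t < 1 ->
    [/\ x.1 \in W, 0 <= x.2 < 1 & t = a x.1 + p x.1 * x.2].
  move=> t; have [t01|] := boolP (0 <= t < 1); last by exists ([::], 0).
  by have [w wW [t' t'01 e]] := ha _ t01; exists (w, t').
pose nxt (t : R) : R := (f t).2; pose word (t : R) := (f t).1.
have nxt01 (t : R) : 0 <= t < 1 -> 0 <= nxt t < 1 by move=> /hf[].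
have it01 (t : R) k : 0 <= t < 1 -> 0 <= iter k nxt t < 1.
  by move=> t01; elim: k => //= k; exact: nxt01.
(* Blocks of length n + 1: the word selected by the corresponding iterate of [nxt], closed by the
   digit 2. *)
pose dig (t : R) k : R[i] := nth 0 (rcons (word (iter (k %/ n.+1) nxt t)) digit2) (k %% n.+1).
have hrc (t : R) : 0 <= t < 1 -> digits (rcons (word t) digit2) /\ size (rcons (word t) digit2) = n.+1.
  move=> /hf[/hW[hw sw] _ _]; rewrite size_rcons sw; split=> //.
  by apply/digits_rcons; split=> //; exact: NplusZi_digit2.
have hdig (t : R) : 0 <= t < 1 -> forall k, NplusZi R (dig t k).
  move=> t01 k; have [hd sd] := hrc _ (it01 _ (k %/ n.+1)%N t01).
  by apply: hd; rewrite mem_nth// sd ltn_mod.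
have /choice[g hg] : forall t : R, exists z, 0 <= t < 1 -> cfvalue (dig t) z.
  move=> t; have [t01|] := boolP (0 <= t < 1); last by exists 0.
  by have [z hz] := cfvalue_exists (hdig _ t01); exists z.
have gd (t : R) : 0 <= t < 1 -> 0 <= depth (g t).
  by move=> t01; apply: cfvalue_depth (hg _ t01); exact: hdig.
have gE (t : R) : 0 <= t < 1 -> g t = cfmap (rcons (word t) digit2) (g (nxt t)).
  move=> t01; have [z hz ->] := cfvalue_shift n.+1 (hdig _ t01) (hg _ t01).
  have [_ sd] := hrc _ t01.
  have -> : g (nxt t) = z.
    apply: cfvalue_unique (hg _ (nxt01 _ t01)) _.
    suff <- : (fun k => dig t (n.+1 + k)%N) = dig (nxt t) by [].
    apply/funext => k; by rewrite /dig modnDl divnDl// divnn -iterSr.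
  congr cfmap; apply: (@eq_from_nth _ 0); rewrite size_mkseq// => i iw.
  by rewrite nth_mkseq// /dig divn_small// modn_small.
(* The losses at the first differing block: 4 from [weight_cat], 9 from [depth_cfmap_digit2], 256
   from [separation]. *)
have [c c0 cm] : exists2 c : R, 0 < c & c * (4 * 9 * 256) <= m.
  by exists (m / (4 * 9 * 256)); lra.
pose C := c^-1 `^ s.
(* Either the expansions differ within k blocks, and separation applies, or they agree for k blocks
   and the numbers are 2^-k close. [mu] stands for the length of the interval coded by [u]; only its
   bound by the s-th power of [weight u] is kept. *)
have key k : forall u (mu t t' : R), digits u -> 0 <= mu <= weight u `^ s ->
    0 <= t < 1 -> 0 <= t' < 1 ->
    mu * `|t - t'| <= C * normc (cfmap u (g t) - cfmap u (g t')) `^ s \/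
    mu * `|t - t'| <= mu * 2^-1 ^+ k.
  elim: k => [|k IH] u mu t t' hu /andP[mu0 mu1] t01 t'01.
    right; rewrite expr0 ler_wpM2l// ler_norml; move/andP: t01; move/andP: t'01.
    by move=> [? ?] [? ?]; apply/andP; split; lra.
  have [wW n01 e] := hf _ t01; have [w'W n'01 e'] := hf _ t'01.
  have [hw sw] := hW _ wW; have [hw' sw'] := hW _ w'W.
  have [ew|nw] := eqVneq (word t) (word t').
    have tt : `|t - t'| = p (word t) * `|nxt t - nxt t'|.
      rewrite {1}e {1}e' -/(word t) -/(word t') -ew -/(nxt t) -/(nxt t').
      rewrite opprD addrACA subrr add0r -mulrBr normrM.
      by rewrite (ger0_norm (ltW (pW _ wW))).
    have [hrd _] := hrc _ t01.
    have hu' : digits (u ++ rcons (word t) digit2) by apply/digits_cat.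
    have mu'1 : 0 <= mu * p (word t) <= weight (u ++ rcons (word t) digit2) `^ s.
      rewrite mulr_ge0 ?(ltW (pW _ wW))//=.
      have wu := weight_gt0 hu; have ww := weight_gt0 hw.
      apply: (@le_trans _ _ ((weight u * weight (word t) / 64) `^ s)); last first.
        apply: ge0_ler_powR; rewrite ?nnegrE ?weight_cat_digit2//.
          by rewrite !mulr_ge0// ltW.
        by rewrite ltW// weight_gt0.
      rewrite !powRM ?mulr_ge0 ?(ltW wu) ?(ltW ww)// -mulrA ler_pM ?(ltW (pW _ wW))//.
      rewrite /p -/(word t) ler_wpM2l ?powR_ge0//.
      rewrite powRV// lef_pV2 ?posrE ?powR_gt0//; lra.
    rewrite tt mulrA; have := IH _ _ _ _ hu' mu'1 n01 n'01.
    rewrite !cfmap_cat -(gE _ t01) -/(nxt t) -/(nxt t') ew -(gE _ t'01) => -[h|h].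
      by left.
    right; apply: le_trans h _; rewrite exprS -mulrA ler_wpM2l// ler_wpM2r ?exprn_ge0//.
    exact: p2.
  left; apply: (@le_trans _ _ (weight u `^ s)).
    rewrite -[leRHS]mulr1 ler_pM//.
    rewrite ler_norml; move/andP: t01; move/andP: t'01.
    by move=> [? ?] [? ?]; apply/andP; split; lra.
  have huw : digits (u ++ word t) by apply/digits_cat.
  have huw' : digits (u ++ word t') by apply/digits_cat.
  have z1 := depth_cfmap_digit2 (gd _ n01).
  have z1' := cfmap_depth digits_digit2 (gd _ n'01).
  have z0 : 0 <= depth (cfmap [:: digit2] (g (nxt t))) by lra.
  have ss : size (u ++ word t) = size (u ++ word t') by rewrite !size_cat sw sw'.
  have nn : u ++ word t <> u ++ word t'.
    by move/eqP; rewrite eqseq_cat// eqxx /= => /eqP E; rewrite E eqxx in nw.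
  have := separation huw huw' ss nn z0 z1'.
  rewrite !cfmap_cat -[cfmap (word t) _]cfmap_cat -[cfmap (word t') _]cfmap_cat.
  rewrite !cats1 -(gE _ t01) -(gE _ t'01) => hsep.
  have /andP[wuw _] := weight_cat hu hw.
  have wu := weight_gt0 hu.
  have hcw : c * weight u <= normc (cfmap u (g t) - cfmap u (g t')).
    apply: le_trans hsep; rewrite -/(word t) in wuw.
    have h1 : weight u * m / 4 <= weight (u ++ word t).
      apply: le_trans wuw; rewrite ler_wpM2r// ler_wpM2l ?(ltW wu)//; exact: hm.
    have h2 : 0 <= weight u * m / 4 by rewrite !mulr_ge0// ltW.
    have h3 : weight u * m / 4 / 9 <=
        weight (u ++ word t) * depth (cfmap [:: digit2] (g (nxt t))) by rewrite ler_pM.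
    move: cm wu h3; clear; move: (weight u) (weight (u ++ _) * _) => X Y cm X0.
    have : X * (c * (4 * 9 * 256)) <= X * m by rewrite ler_pM2l.
    lra.
  rewrite /C -powRM ?invr_ge0 ?(ltW c0) ?normc_ge0//.
  apply: ge0_ler_powR; rewrite ?nnegrE ?(ltW wu)//.
    by rewrite mulr_ge0 ?normc_ge0// invr_ge0 ltW.
  by rewrite mulrC ler_pdivlMr// mulrC.
exists g, C; split; first exact: powR_ge0.
  by move=> t t01; apply/F_NplusZiP; exists (dig t); [exact: hdig|exact: hg].
move=> t t' t01 t'01; rewrite leNgt; apply/negP => h.
have hnil : digits ([::] : seq R[i]) by move=> ?; rewrite in_nil.
suff : `|t - t'| <= 0.
  move=> h0; have := lt_le_trans h h0; apply/negP; rewrite -leNgt.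
  by rewrite mulr_ge0 ?powR_ge0.
apply: (@le0_geometric _ _ 1 (2^-1)) => [|k]; first by apply/andP; split; lra.
have := key k [::] 1 t t' hnil; rewrite weight_nil powR1 lexx ler01 !mul1r /=.
by move=> /(_ isT t01 t'01)[|//]; rewrite leNgt h.
Qed.

Lemma diam_ge (U : set R[i]) z z' : U z -> U z' -> ((normc (z - z'))%:E <= diam U)%E.
Proof. by move=> Uz Uz'; apply: ereal_sup_ubound; exists (z, z'). Qed.

Lemma diam_pow_ge0 (s : R) (U : set R[i]) : (0 <= diam_pow s U)%E.
Proof. by rewrite /diam_pow; case: asboolP => // _; exact: poweR_ge0. Qed.

(** The preimage under [g] of a set of diameter d lies in an interval of length 2 C d^s. A cover of
    E thus yields intervals covering [0, 1), of total length at least 1, which bounds the sum of the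
    d^s below. *)
Lemma hausdorff_measure_neq0 (s C : R) (g : R -> R[i]) (E : set R[i]) :
  0 <= s -> 0 <= C -> (forall t : R, 0 <= t < 1 -> E (g t)) ->
  (forall t t' : R, 0 <= t < 1 -> 0 <= t' < 1 ->
      `|t - t'| <= C * normc (g t - g t') `^ s) ->
  hausdorff_measure s E <> 0%E.
Proof.
move=> s0 C0 gE gC H0.
(* A value below 1 / (2 C) that remains meaningful for C = 0. *)
have e0 : 0 < (2 * (2 * C + 1))^-1 by rewrite invr_gt0; lra.
have : (hausdorff_premeasure s 1 E < (2 * (2 * C + 1))^-1%:E)%E.
  apply: (@le_lt_trans _ _ 0%E); last by rewrite lte_fin.
  by rewrite -H0; apply: ereal_sup_ubound; exists 1 => //=; rewrite ltr01.
move=> /ereal_inf_lt[_ [U [EU dU] <-]] hlt.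
have /choice[J hJ] : forall k, exists J : set R, [/\ measurable J,
    (forall t : R, 0 <= t < 1 -> U k (g t) -> J t) &
    (lebesgue_measure J <= (2 * C)%:E * diam_pow s (U k))%E].
  move=> k; have [[t0 [t01 Ut0]]|no] := pselect (exists t, 0 <= t < 1 /\ U k (g t)); last first.
    exists set0; split=> //; first by move=> t t01 Ut; apply: no; exists t.
    by rewrite measure0 mule_ge0 ?diam_pow_ge0// lee_fin mulr_ge0.
  have d0 : (0 <= diam (U k))%E.
    by apply: le_trans (diam_ge Ut0 Ut0); rewrite subrr normc0.
  have /fineK dE : diam (U k) \is a fin_num 
    by rewrite ge0_fin_numE// (le_lt_trans (dU k))// ltry.
  set d := fine (diam (U k)) in dE; have dd : 0 <= d by rewrite -lee_fin dE.
  pose l := C * d `^ s; have l0 : 0 <= l by rewrite mulr_ge0 ?powR_ge0.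
  exists `[t0 - l, t0 + l]%classic; split.
  - exact: measurable_itv.
  - move=> t t01' Ut; have : `|t0 - t| <= l.
      apply: le_trans (gC _ _ t01 t01') _; rewrite ler_wpM2l//.
      apply: ge0_ler_powR; rewrite ?nnegrE ?normc_ge0//.
      by rewrite -lee_fin dE; exact: diam_ge.
    by rewrite ler_norml /= in_itv /= => /andP[h1 h2]; apply/andP; split; lra.
  - rewrite lebesgue_measure_itv /diam_pow; case: asboolP => [U0|_].
      by move: Ut0; rewrite U0.
    rewrite -dE poweR_EFin -EFinM /=; case: ifP => _; last first.
      by rewrite lee_fin mulr_ge0 ?mulr_ge0 ?powR_ge0.
    by rewrite -EFinD lee_fin /l; lra.
have cov : `[0, 1[%classic `<=` \bigcup_k J k.
  move=> t; rewrite /= in_itv /= => t01.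
  have [k _ Uk] := EU _ (gE _ t01); exists k => //.
  by have [_ h _] := hJ k; exact: h.
have mJ k : measurable (J k) by have [] := hJ k.
have : (lebesgue_measure (`[0%R, 1%R[%classic : set R) <=
    \sum_(0 <= k <oo) lebesgue_measure (J k))%E.
  exact: (measure_sigma_subadditive lebesgue_measure mJ (measurable_itv _) cov).
rewrite lebesgue_measure_itv /= lte_fin ltr01 oppr0 adde0 => h1.
apply: (negP (_ : ~~ (1 <= \sum_(0 <= k <oo) lebesgue_measure (J k))%E)) h1.
rewrite -ltNge.
apply: (@le_lt_trans _ _ (\sum_(0 <= k <oo) ((2 * C)%:E * diam_pow s (U k)))%E).
  by apply: lee_nneseries => [k _ _|k _]; [exact: measure_ge0|have [] := hJ k].
rewrite nneseriesZl; last by move=> k _; exact: diam_pow_ge0.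
have s00 : (0 <= \sum_(0 <= k <oo) diam_pow s (U k))%E.
  by apply: nneseries_ge0 => k _ _; exact: diam_pow_ge0.
move: s00 hlt; case: (\sum_(0 <= k <oo) _)%E => // r r0 hr.
rewrite -EFinM lte_fin; rewrite lee_fin in r0; rewrite lte_fin in hr.
have : r * (2 * (2 * C + 1)) < 1 by rewrite -ltr_pdivlMr ?div1r//; lra.
by nra.
Qed.

Lemma weight_sum_level (s : R) (n : nat) (W : seq (seq R[i])) : 0 <= s ->
  hausdorff_measure s (F_NplusZi R) = 0%E ->
  uniq W -> {in W, forall w, digits w /\ size w = n} ->
  \sum_(w <- W) weight w `^ s <= 2 * 64 `^ s.
Proof.
move=> s0 H0 uW hW; rewrite leNgt; apply/negP => /ltW h.
have [g [C [C0 gF gC]]] := cf_coding s0 uW hW h.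
exact: hausdorff_measure_neq0 s0 C0 gF gC H0.
Qed.

(** On words of length n, the extra factor of exponent s - s0 is at most a constant times q^n by
    [weight_decay], while the sums of exponent s0 are bounded by [weight_sum_level]. *)
Lemma weight_sum_all (s0 s : R) : 0 <= s0 -> s0 < s ->
  hausdorff_measure s0 (F_NplusZi R) = 0%E ->
  exists2 A : R, 0 <= A & forall W : seq (seq R[i]), uniq W ->
    {in W, forall w, digits w} -> \sum_(w <- W) weight w `^ s <= A.
Proof.
move=> s00 ss H0; set K := 2 * 64 `^ s0.
pose q : R := (3 / 4) `^ (s - s0).
have q1 : q < 1 by apply: powR_lt1; [apply/andP; split; lra|lra].
have q0 : 0 <= q by exact: powR_ge0.
have K0 : 0 <= K by rewrite mulr_ge0 ?powR_ge0.
exists (K * (4 / 3) `^ (s - s0) / (1 - q)).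
  by rewrite divr_ge0 ?subr_ge0 ?mulr_ge0 ?powR_ge0// ltW.
move=> W uW hW; apply: (@sum_geometric_le _ _ W size).
- by rewrite q0.
- by rewrite mulr_ge0 ?powR_ge0.
move=> n; rewrite -big_filter.
apply: (@le_trans _ _ (\sum_(w <- [seq w <- W | size w == n])
    weight w `^ s0 * ((4 / 3) `^ (s - s0) * q ^+ n))).
  rewrite !big_seq; apply: ler_sum => w; rewrite mem_filter => /andP[/eqP sw wW].
  have w0 := weight_gt0 (hW _ wW).
  have -> : weight w `^ s = weight w `^ s0 * weight w `^ (s - s0).
    by rewrite -powRD ?(gt_eqF w0) ?implybT// addrC subrK.
  rewrite ler_wpM2l ?powR_ge0// -powR_exprn; last by lra.
  rewrite -powRM ?exprn_ge0//; try lra.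
  apply: ge0_ler_powR; rewrite ?nnegrE ?subr_ge0 ?(ltW ss) ?(ltW w0)//.
  by rewrite -sw; exact/weight_decay/hW.
rewrite -mulr_suml -mulrA ler_wpM2r ?mulr_ge0 ?powR_ge0 ?exprn_ge0//.
apply: (@weight_sum_level _ n) => //; first exact: filter_uniq.
by move=> w; rewrite mem_filter => /andP[/eqP sw wW]; split=> //; exact: hW.
Qed.

End HausdorffLowerBound.

(** * Counting cylinders and covering the tails *)

Section CoveringUpperBound.
Variable R : realType.
Implicit Types (x y z : R[i]) (w u v p : seq R[i]).

Lemma powR_expR (x a : R) : 0 < x -> x `^ a = expR (a * ln x).
Proof. by move=> x0; rewrite /powR gt_eqF. Qed.

Lemma normcR (a : R) : normc a%:C = `|a|.
Proof. by rewrite /normc /= expr0n addr0 sqrtr_sqr. Qed.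

(** Used with a = rho and c the weight of the parent. At d = a^2 / c, where the two counts of
    children meet, both give a^(2s - 2) c^(2 - s), which can be summed over parents. *)
Lemma powR_balance_small (a c s : R) : 0 < a -> 0 < c ->
  c * (a ^+ 2 / c) `^ (s - 1) = a `^ (2 * s - 2) * c `^ (2 - s).
Proof.
move=> a0 c0; have d0 : 0 < a ^+ 2 / c by rewrite divr_gt0// exprn_gt0.
rewrite -[X in X * _ = _](powRr1 (ltW c0)) !powR_expR// -!expRD; congr expR.
by rewrite ln_div ?posrE ?exprn_gt0// lnXn//; ring.
Qed.

Lemma powR_balance_large (a c s : R) : 0 < a -> 0 < c ->
  a ^+ 2 * (a ^+ 2 / c)^-1 `^ (- s - - 2) = a `^ (2 * s - 2) * c `^ (2 - s).
Proof.
move=> a0 c0; have d0 : 0 < a ^+ 2 / c by rewrite divr_gt0// exprn_gt0.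
have -> : a ^+ 2 = a `^ 2 by rewrite powR_mulrn// ltW.
rewrite powR_mulrn ?(ltW a0)// !powR_expR ?invr_gt0//.
have -> : a ^+ 2 = expR (2 * ln a) by rewrite -powR_expR// powR_mulrn// ltW.
rewrite -!expRD; congr expR.
rewrite lnV ?posrE ?divr_gt0 ?expR_gt0// ln_div ?posrE ?expR_gt0// expRK.
ring.
Qed.

Lemma exists_enumeration (T : eqType) (P : T -> Prop) (N : nat) :
  (forall s, uniq s -> {in s, forall i, P i} -> (size s <= N)%N) ->
  exists2 s, uniq s & forall i, i \in s <-> P i.
Proof.
move=> hN; pose Q (s : seq T) := uniq s /\ {in s, forall i, P i}.
have [||s [us Ps] smax] := @exists_longest _ Q N; first by split.
- by move=> s [us Ps]; exact: hN.
exists s => // i; split=> [/Ps//|Pi]; apply: contraT => nis.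
suff /smax : Q (i :: s) by rewrite ltnn.
by split=> [|j]; rewrite /= ?nis// inE => /orP[/eqP->|/Ps].
Qed.

(** The word v stops just before the weight drops below r. Its next digit b then satisfies |b + t|^2
    > weight v / r, so the tail y = 1/(b + y') is close to 0. The factor 4 is from |b + t| <= 2 |b +
    y'|. *)
Lemma tail_decomposition z (r : R) : F_NplusZi R z -> 0 < r <= 1 ->
  exists v y, [/\ digits v, r <= weight v, 0 <= depth y, z = cfmap v y &
    normc y ^+ 2 <= 4 * r / weight v].
Proof.
move=> /F_NplusZiP[b hb hz] /andP[r0 r1].
have ex : exists n, weight (mkseq b n) < r.
  have [|N hN] := @geometric_small R (4 / 3) (3 / 4) r _ r0.
    by apply/andP; split; lra.
  exists N; apply: le_lt_trans (hN N (leqnn N)).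
  by have := weight_decay (digits_mkseq (n := N) hb); rewrite size_mkseq.
case: (ex_minnP ex) => [[|n]] hn nmin.
  by move: hn; rewrite weight_nil ltNge r1.
have wn : r <= weight (mkseq b n).
  by rewrite leNgt; apply/negP => /nmin; rewrite ltnn.
have hdn := digits_mkseq (n := n) hb.
have [y hy zy] := cfvalue_shift n hb hz.
have [y' hy' yy'] := cfvalue_shift 1 (fun k => hb (n + k)%N) hy.
have hd' := cfvalue_depth (fun k => hb (n + (1 + k))%N) hy'.
exists (mkseq b n), y; split=> //.
  exact: cfvalue_depth (fun k => hb (n + k)%N) hy.
have mS : mkseq b n.+1 = rcons (mkseq b n) (b n).
  by rewrite mkseqS.
have [t ht wt] := weight_rcons hdn (hb n).
rewrite mS wt in hn.
have ye : y = (b n + y')^-1 by rewrite yy' /mkseq /= addn0.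
have B1 := normc_add_depth (hb n) hd'; have T1 := normc_add_depth (hb n) ht.
have TB : normc (b n + t) <= 2 * normc (b n + y').
  have -> : b n + t = (b n + y') + (t - y') by ring.
  by rewrite (le_trans (le_normcD _ _))//; have := depth_dist1 ht hd'; lra.
rewrite ye normcV exprVn.
have w0 := weight_gt0 hdn.
rewrite ltr_pdivrMr in hn; last by rewrite exprn_gt0//; lra.
have TB2 : normc (b n + t) ^+ 2 <= (2 * normc (b n + y')) ^+ 2.
  by rewrite ler_sqr ?nnegrE; lra.
rewrite ler_pdivlMr// mulrC ler_pdivrMr ?exprn_gt0//; last by lra.
by rewrite exprMn in TB2; have : r * normc (b n + t) ^+ 2 <=
  r * (2 ^+ 2 * normc (b n + y') ^+ 2); [rewrite ler_pM2l|lra].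
Qed.

(** The points assigned to v lie within a multiple of sqrt(r weight v) of [cfmap v 0], hence need
    about weight v / r balls. With q = weight v / r >= 1 and t^2 = 16 q, one has 16 (1 + t)^2 <= 32
    (1 + 16 q) <= 544 q. *)
Lemma covering_number_le_weights (E : set R[i]) (r : R) (V : seq (seq R[i])) :
  0 < r <= 1 -> E `<=` F_NplusZi R ->
  {in V, forall v, digits v /\ r <= weight v} ->
  (forall v, digits v -> r <= weight v ->
    (exists2 y, 0 <= depth y & E (cfmap v y)) -> v \in V) ->
  (covering_number r E <= (544 * \sum_(v <- V) weight v / r)%:E)%E.
Proof.
move=> r01 EF hV Vall; have /andP[r0 r1] := r01.
pose T v := [set z | exists2 y, z = cfmap v y &
  0 <= depth y /\ normc y ^+ 2 <= 4 * r / weight v].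
have /choice[net hnet] : forall v, exists s : seq R[i], v \in V ->
    (forall z, T v z -> exists2 c, c \in s & normc (z - c) < r) /\
    (size s)%:R <= 544 * (weight v / r).
  move=> v; have [vV|] := boolP (v \in V); last by exists [::].
  have [hv rv] := hV _ vV; have w0 := weight_gt0 hv.
  have rw0 : 0 <= r * weight v by rewrite mulr_ge0// ltW.
  pose rho := 4 * Num.sqrt (r * weight v).
  have rho2 : rho ^+ 2 = 16 * (r * weight v).
    by rewrite exprMn sqr_sqrtr//; ring.
  have rho0 : 0 <= rho by rewrite mulr_ge0// sqrtr_ge0.
  have hT z : T v z -> normc (z - cfmap v 0) <= rho.
    move=> [y -> [hy hy2]]; apply: normc_le_sqr => //.
    have h0 : 0 <= depth (0 : R[i]) by rewrite depth0.
    have := cfmapB_le hv hy h0; rewrite subr0 => h1.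
    apply: (@le_trans _ _ ((16 / 9 * weight v * normc y) ^+ 2)).
      by rewrite ler_sqr ?nnegrE ?normc_ge0// !mulr_ge0 ?normc_ge0// ltW.
    rewrite exprMn rho2; rewrite ler_pdivlMr// in hy2.
    have : weight v * (normc y ^+ 2 * weight v) <= weight v * (4 * r).
      by rewrite ler_pM2l.
    have : 0 <= weight v * r by rewrite mulr_ge0// ltW.
    rewrite exprMn; move: (normc y ^+ 2) => Y; lra.
  have [s [us sT ss scov]] := exists_net r0 rho0 hT.
  exists s => _; split=> //.
  have := separated_size us r0 rho0 ss (fun c cs => hT _ (sT _ cs)).
  move/le_trans; apply.
  have q1 : 1 <= weight v / r by rewrite ler_pdivlMr// mul1r.
  have : (rho / r) ^+ 2 = 16 * (weight v / r).
    by rewrite exprMn rho2; field; rewrite gt_eqF.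
  move: q1 (rho / r) => q1 t ht; have := sqr_ge0 (1 - t).
  by rewrite sqrrB sqrrD ht; lra.
apply: le_trans (covering_number_le (s := flatten (map net V)) _) _.
  move=> z Ez; have [v [y [hv rv hy zy hy2]]] := tail_decomposition (EF _ Ez) r01.
  have vV : v \in V by apply: Vall => //; exists y => //; rewrite -zy.
  have [hcov _] := hnet _ vV.
  have [|c cs zc] := hcov z; first by exists y.
  by exists c => //; apply/flattenP; exists (net v) => //; exact: map_f.
rewrite lee_fin size_flatten /shape sumnE -map_comp big_map natr_sum.
rewrite mulr_sumr !big_seq; apply: ler_sum => v vV.
by have [] := hnet _ vV.
Qed.

(* A point of a cylinder of weight at least [e] is moved by at most [e] so as to
   have depth of order [e / weight w]; by [separation] the moved points are
   separated in proportion to [e]. *)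
Lemma count_words : exists2 C : R, 0 < C & forall x (e rho : R) n (W : seq (seq R[i])),
  0 < e -> 0 <= rho -> uniq W ->
  {in W, forall w, [/\ digits w, size w = n, e <= weight w &
    exists2 y, 0 <= depth y & normc (cfmap w y - x) <= rho]} ->
  (size W)%:R <= C * (1 + rho / e) ^+ 2.
Proof.
(* The moved points are e / 1024 apart, 1/4 coming from their depth and 1/256 from [separation], and
   lie within rho + e of x. *)
exists (16 * (1 + 256 * 4) ^+ 2); first by apply: mulr_gt0; [lra|apply: exprn_gt0; lra].
move=> x e rho n W e0 rho0 uW hW.
have /choice[f hf] : forall w, exists z, w \in W ->
    [/\ 0 <= depth z, e / 4 <= weight w * depth z & normc (cfmap w z - x) <= rho + e].
  move=> w; have [wW|] := boolP (w \in W); last by exists 0.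
  have [hw _ ew [y hy yx]] := hW _ wW; have w0 := weight_gt0 hw.
  pose eta := e / weight w.
  have eta1 : 0 < eta <= 1 by rewrite divr_gt0//= ler_pdivrMr// mul1r.
  have /andP[eta0 eta1'] := eta1.
  (* Contraction towards the centre by 1 - eta: the depth becomes at least (1 - (1 - eta)^2) / 4 >=
     eta / 4, and y moves by at most eta / 2. *)
  pose z := y + eta%:C * ((2^-1)%:C - y).
  have hd : eta / 4 <= depth z.
    rewrite depthE.
    have -> : z - (2^-1)%:C = (1 - eta)%:C * (y - (2^-1)%:C).
      by rewrite /z rmorphB rmorph1; ring.
    rewrite normcM exprMn; have -> : normc (1 - eta)%:C ^+ 2 = (1 - eta) ^+ 2.
      by rewrite sqr_normc_ReIm /= expr0n addr0.
    rewrite depthE in hy; move: (normc (y - _) ^+ 2) (sqr_ge0 (normc (y - (2^-1)%:C))) hy.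
    move=> Y Y0 hy; have h : (1 - eta) ^+ 2 * Y <= (1 - eta) ^+ 2 * 4^-1.
      by rewrite ler_wpM2l ?sqr_ge0//; lra.
    by nra.
  exists z => _; have z0 : 0 <= depth z by apply: le_trans hd; lra.
  split=> //.
    have -> : e / 4 = weight w * (eta / 4) by rewrite /eta; field; rewrite gt_eqF.
    by rewrite ler_pM2l.
  rewrite (le_trans (normc_triangle (cfmap w y) _ _))// addrC lerD//.
  apply: le_trans (cfmapB_le hw z0 hy) _.
  have -> : z - y = eta%:C * ((2^-1)%:C - y) by rewrite /z; ring.
  rewrite normcM normc_distC; have -> : normc eta%:C = eta.
    by rewrite normcR gtr0_norm.
  have := dist_half hy; rewrite /eta; set Y : R := normc _ => hY.
  have -> : 16 / 9 * weight w * (e / weight w * Y) = 16 / 9 * e * Y.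
    by field; rewrite gt_eqF.
  by nra.
have d0 : 0 < e / 4 / 256 by lra.
have re0 : 0 <= rho + e by lra.
have sep : is_separated (fun w => cfmap w (f w)) (e / 4 / 256) W.
  move=> u v uW' vW /eqP uv.
  have [hu su _ _] := hW _ uW'; have [hv sv _ _] := hW _ vW.
  have [du wu _] := hf _ uW'; have [dv _ _] := hf _ vW.
  have := separation hu hv (etrans su (esym sv)) uv du dv.
  by apply: le_trans; rewrite ler_pM2r ?invr_gt0//; lra.
have hx : {in W, forall w, normc (cfmap w (f w) - x) <= rho + e}.
  by move=> w wW; have [] := hf _ wW.
apply: le_trans (separated_size uW d0 re0 sep hx) _.
rewrite -[leRHS]mulrA ler_pM2l; last by lra.
have -> : (rho + e) / (e / 4 / 256) = 256 * 4 * (1 + rho / e).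
  by field; rewrite gt_eqF.
have : 0 <= rho / e by rewrite divr_ge0// ltW.
move: (rho / e) => t t0; rewrite -exprMn ler_sqr ?nnegrE; try lra.
Qed.

(* The children of [w] of weight about [d] that come [rho]-close to [x] number at
   most [(rho / d)^2] by area, and at most [weight w / d] by the spacing of the
   digits, up to constants; the two bounds agree at [d = rho^2 / weight w]. *)
Lemma children_sum (s : R) : 1 < s < 2 -> exists2 C : R, 0 <= C &
  forall x (rho : R) w (P : seq (seq R[i])), 0 < rho -> digits w -> uniq P ->
  rho <= weight w ->
  {in P, forall p, [/\ exists2 b, p = rcons w b & NplusZi R b, weight p < rho &
    exists2 y, 0 <= depth y & normc (cfmap p y - x) <= rho]} ->
  \sum_(p <- P) weight p `^ s <= C * (rho `^ (2 * s - 2) * weight w `^ (2 - s)).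
Proof.
move=> /andP[s1 s2]; have [C C0 hC] := count_words.
(* With q = weight w / d, 132 q bounds (1 + t)^2 <= 2 + 2 t^2 for t^2 = 64 q and 2 q >= 1. In [C2],
   4 t^2 bounds (1 + t)^2 for t >= 1. *)
pose C1 : R := 2 `^ `|s| / (1 - 2^-1 `^ (s - 1)) * (132 * C).
pose C2 : R := 2 `^ `|- s| / (1 - 2^-1 `^ (- s - - 2)) * (4 * C).
have half01 : 0 <= (2^-1 : R) < 1 by apply/andP; split; lra.
have k1 : 0 < 1 - (2^-1 : R) `^ (s - 1) by rewrite subr_gt0 powR_lt1// subr_gt0.
have k2 : 0 < 1 - (2^-1 : R) `^ (- s - - 2) by rewrite subr_gt0 powR_lt1//; lra.
have C10 : 0 <= C1 by rewrite /C1 mulr_ge0 ?divr_ge0 ?powR_ge0//; lra.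
have C20 : 0 <= C2 by rewrite /C2 mulr_ge0 ?divr_ge0 ?powR_ge0//; lra.
exists (C1 + C2); first exact: addr_ge0.
move=> x rho w P rho0 hw uP rw hP.
have w0 := weight_gt0 hw.
have hd p : p \in P -> [/\ digits p, size p = (size w).+1, 0 < weight p & weight p <= weight w].
  move=> /hP[[b -> hb] _ _]; have hp : digits (rcons w b) by apply/digits_rcons.
  by rewrite size_rcons weight_gt0// weight_rcons_le.
pose d0 := rho ^+ 2 / weight w.
have d00 : 0 < d0 by rewrite divr_gt0// exprn_gt0.
rewrite (bigID (fun p => weight p <= d0)) /= mulrDl lerD//.
- rewrite -big_filter.
  have := @sum_dyadic_le R _ [seq p <- P | weight p <= d0] (@weight R) s 1
    (132 * C * weight w) d0 s1 _ d00 _ _.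
  have -> : C1 * (rho `^ (2 * s - 2) * weight w `^ (2 - s)) =
      2 `^ `|s| * (132 * C * weight w * d0 `^ (s - 1)) / (1 - 2^-1 `^ (s - 1)).
    have eqd : weight w * d0 `^ (s - 1) = rho `^ (2 * s - 2) * weight w `^ (2 - s).
      exact: powR_balance_small.
    by rewrite -[132 * C * _ * _]mulrA eqd /C1; ring.
  apply.
  + by rewrite !mulr_ge0//; [lra|exact: ltW].
  + by move=> p; rewrite mem_filter => /andP[pd /hd[_ _ -> _]].
  move=> d /andP[dp dd0]; rewrite powR_inv1; last exact: ltW.
  rewrite -filter_predI; set W := seq.filter _ P.
  have uW : uniq W by exact: filter_uniq.
  have [->|] := eqVneq W [::].
    by rewrite divr_ge0 ?(ltW dp)// !mulr_ge0//; [lra|exact: ltW].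
  rewrite -size_eq0 -lt0n -has_predT => /hasP[p0 + _].
  rewrite mem_filter => /andP[/= /andP[/andP[p01 _] _] /hd[_ _ _ p02]].
  (* A child of weight at most d has a digit of modulus at least sqrt(weight w / d) / 2, so it comes
     this close to [cfmap w 0]. The count is therefore centred there and not at x. *)
  have rr0 : 0 <= 4 * Num.sqrt (d * weight w) by rewrite mulr_ge0// sqrtr_ge0.
  have e0 : 0 < d / 2 by lra.
  have := hC (cfmap w 0) (d / 2) (4 * Num.sqrt (d * weight w)) (size w).+1 W e0 rr0 uW.
  move=> /(_ _)/le_trans; apply.
    move=> p; rewrite mem_filter => /andP[/= /andP[/andP[pd1 pd2] _] pP].
    have [hp sp pw0 _] := hd _ pP; split=> //.
    have [[b eb hb] _ _] := hP _ pP; exists 0; first by rewrite depth0.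
    have h0 : 0 <= depth (0 : R[i]) by rewrite depth0.
    rewrite eb -cats1 cfmap_cat /= addr0.
    have hbi : 0 <= depth b^-1 by apply/depth_inv_ge0/NplusZi_Re.
    have := cfmapB_le hw hbi h0; rewrite subr0 => h1.
    apply: normc_le_sqr => //.
    apply: (@le_trans _ _ ((16 / 9 * weight w * normc b^-1) ^+ 2)).
      by rewrite ler_sqr ?nnegrE ?normc_ge0// !mulr_ge0 ?normc_ge0// ltW.
    have [t ht wt] := weight_rcons hw hb; rewrite eb wt in pd2.
    have B1 := normc_ge1 (NplusZi_Re hb); have T1 := normc_add_depth hb ht.
    have TB : normc (b + t) <= 2 * normc b.
      by rewrite (le_trans (le_normcD _ _))//; have := normc_depth ht; lra.
    have TB2 : normc (b + t) ^+ 2 <= 4 * normc b ^+ 2.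
      have -> : 4 * normc b ^+ 2 = (2 * normc b) ^+ 2 by ring.
      by rewrite ler_sqr ?nnegrE; lra.
    have bb0 : 0 < normc b ^+ 2 by rewrite exprn_gt0//; lra.
    rewrite ler_pdivrMr in pd2; last by rewrite exprn_gt0//; lra.
    have pd3 : weight w / normc b ^+ 2 <= 4 * d.
      rewrite ler_pdivrMr//; apply: le_trans pd2 _.
      have : d * normc (b + t) ^+ 2 <= d * (4 * normc b ^+ 2) by rewrite ler_pM2l.
      lra.
    have -> : (4 * Num.sqrt (d * weight w)) ^+ 2 = 16 * (d * weight w).
      by rewrite exprMn sqr_sqrtr; [ring|rewrite mulr_ge0// ltW].
    have -> : (16 / 9 * weight w * normc b^-1) ^+ 2 =
        256 / 81 * (weight w * (weight w / normc b ^+ 2)).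
      by rewrite normcV; field; rewrite gt_eqF//; lra.
    have : weight w * (weight w / normc b ^+ 2) <= weight w * (4 * d) by rewrite ler_pM2l.
    have : 0 <= weight w * d by rewrite mulr_ge0// ltW.
    by move: (weight w * (weight w / _)) => Y; lra.
  have : (4 * Num.sqrt (d * weight w) / (d / 2)) ^+ 2 = 64 * (weight w / d).
    rewrite !exprMn sqr_sqrtr; last by rewrite mulr_ge0// ltW.
    by field; rewrite gt_eqF.
  have : 1 <= 2 * (weight w / d) by rewrite mulrA ler_pdivlMr//; lra.
  rewrite -!mulrA [132 * _]mulrCA ler_pM2l//.
  move: (weight w / d) (_ / (d / 2)) => q t q1 ht.
  by have := sqr_ge0 (1 - t); rewrite sqrrB sqrrD ht; lra.
- rewrite -big_filter.
  (* Weights above [d0] are summed through their inverses, which lie below 1 / d0; the area count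
     then grows like d^2 and -2 < -s makes the dyadic sum converge. *)
  have := @sum_dyadic_le R _ [seq p <- P | ~~ (weight p <= d0)]
    (fun p => (weight p)^-1) (- s) (- 2) (4 * C * rho ^+ 2) d0^-1.
  have -> : C2 * (rho `^ (2 * s - 2) * weight w `^ (2 - s)) =
      2 `^ `|- s| * (4 * C * rho ^+ 2 * d0^-1 `^ (- s - - 2)) / (1 - 2^-1 `^ (- s - - 2)).
    have eqd : rho ^+ 2 * d0^-1 `^ (- s - - 2) = rho `^ (2 * s - 2) * weight w `^ (2 - s).
      exact: powR_balance_large.
    by rewrite -[4 * C * _ * _]mulrA eqd /C2; ring.
  move=> h; apply: le_trans (h _ _ _ _ _).
  + rewrite !big_seq; apply: ler_sum => p; rewrite mem_filter => /andP[_ /hd[_ _ pw0 _]].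
    by rewrite powRV ?(ltW pw0)// powRN invrK.
  + by lra.
  + by rewrite !mulr_ge0 ?sqr_ge0//; lra.
  + by rewrite invr_gt0.
  + move=> p; rewrite mem_filter -ltNge => /andP[pd /hd[_ _ pw0 _]].
    by rewrite invr_gt0 pw0 lef_pV2 ?posrE// ltW.
  move=> d /andP[dp dd0]; rewrite opprK powR_mulrn; last exact: ltW.
  rewrite -filter_predI; set W := seq.filter _ P.
  have uW : uniq W by exact: filter_uniq.
  have [->|] := eqVneq W [::].
    by rewrite /= !mulr_ge0 ?sqr_ge0//; lra.
  rewrite -size_eq0 -lt0n -has_predT => /hasP[p0 + _].
  have e0 : 0 < d^-1 by rewrite invr_gt0.
  have WP p : p \in W -> [/\ p \in P & d^-1 <= weight p].
    rewrite mem_filter => /andP[/= /andP[/andP[_ h2] _] pP]; split=> //.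
    have [_ _ pw0 _] := hd _ pP.
    by rewrite -div1r ler_pdivrMr// -ler_pdivrMl// mulr1.
  move=> /WP[p0P pd0].
  have := hC x d^-1 rho (size w).+1 W e0 (ltW rho0) uW.
  move=> /(_ _)/le_trans; apply.
    move=> p /WP[pP pd]; have [hp sp _ _] := hd _ pP.
    by have [_ _ hy] := hP _ pP.
  rewrite invrK [4 * C]mulrC -!mulrA ler_pM2l//.
  have [_ p0r _] := hP _ p0P.
  have : 1 <= rho * d.
    by rewrite -ler_pdivrMr// div1r ltW// (le_lt_trans pd0).
  have -> : 4 * (rho * (rho * d ^+ 2)) = 4 * (rho * d) ^+ 2 by ring.
  by move: (rho * d) => t t1; nra.
Qed.

End CoveringUpperBound.

(** * The covering number of F in a disc *)

Section CoveringUpperBoundSum.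
Variable R : realType.
Implicit Types (x y z : R[i]) (w u v p : seq R[i]).

Lemma powR_balance_inv (a c s : R) : 0 < a -> 0 < c ->
  c `^ (- s) * a `^ (2 * s - 2) = c^-1 * (a ^+ 2 / c) `^ (s - 1).
Proof.
move=> a0 c0; have d0 : 0 < a ^+ 2 / c by rewrite divr_gt0// exprn_gt0.
rewrite -[X in _ = X * _](powR_inv1 (ltW c0)) !powR_expR// -!expRD; congr expR.
by rewrite ln_div ?posrE ?exprn_gt0// lnXn//; ring.
Qed.

Definition reaches w x (rho : R) :=
  exists2 y, 0 <= depth y & normc (cfmap w y - x) <= rho.

Lemma reaches_prefix u v x (rho : R) : digits v -> reaches (u ++ v) x rho -> reaches u x rho.
Proof.
by move=> hv [y hy]; rewrite cfmap_cat => h; exists (cfmap v y) => //; exact: cfmap_depth.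
Qed.

(** At each length, [count_words] with e = rho leaves at most 4 C words, and their weights decay
    geometrically with the length. *)
Lemma sum_levels (e : R) : 0 < e -> exists2 C : R, 0 <= C &
  forall x (rho : R) (W : seq (seq R[i])), 0 < rho -> uniq W ->
  {in W, forall w, [/\ digits w, rho <= weight w & reaches w x rho]} ->
  \sum_(w <- W) weight w `^ e <= C.
Proof.
move=> e0; have [C C0 hC] := @count_words R.
pose q : R := (3 / 4) `^ e.
have q0 : 0 <= q by exact: powR_ge0.
have q1 : q < 1 by apply: powR_lt1 => //; apply/andP; split; lra.
exists (C * 4 * (4 / 3) `^ e / (1 - q)).
  by rewrite divr_ge0 ?subr_ge0 ?(ltW q1)// mulr_ge0 ?powR_ge0//; lra.
move=> x rho W rho0 uW hW; apply: (@sum_geometric_le _ _ W size).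
- by rewrite q0.
- by rewrite mulr_ge0 ?powR_ge0//; lra.
move=> n; rewrite -big_filter; set V := [seq w <- W | _].
apply: (@le_trans _ _ (\sum_(w <- V) ((4 / 3) `^ e * q ^+ n))).
  rewrite !big_seq; apply: ler_sum => w; rewrite mem_filter => /andP[/eqP sw wW].
  have [hw _ _] := hW _ wW; have w0 := weight_gt0 hw.
  rewrite -powR_exprn; last by lra.
  rewrite -powRM ?exprn_ge0//; try lra.
  apply: ge0_ler_powR; rewrite ?nnegrE ?(ltW e0) ?(ltW w0)//.
  by rewrite -sw; exact: weight_decay.
rewrite big_const_seq count_predT iter_addr_0 -[_ *+ size _]mulr_natl.
rewrite -mulrA ler_wpM2r ?mulr_ge0 ?powR_ge0 ?exprn_ge0//.
have hV : {in V, forall w, [/\ digits w, size w = n, rho <= weight w & reaches w x rho]}.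
  by move=> w; rewrite mem_filter => /andP[/eqP sw /hW[hw rw hr]]; split.
have := hC x rho rho n V rho0 (ltW rho0) (filter_uniq _ uW) hV.
by rewrite divff ?gt_eqF//; lra.
Qed.

(** Cut each v after the first prefix p of weight below rho. The continuations of p contribute a
    factor A, the p with a common parent are summed by [children_sum], and the parents, of weight at
    least rho, by [sum_levels] with exponent 2 - s > 0. *)
Lemma sum_small_words (s A : R) : 1 < s < 2 ->
  (forall W : seq (seq R[i]), uniq W -> {in W, forall w, digits w} ->
    \sum_(w <- W) weight w `^ s <= A) ->
  exists2 C : R, 0 <= C & forall x (rho : R) (V : seq (seq R[i])),
  0 < rho <= 1 -> uniq V ->
  {in V, forall v, [/\ digits v, weight v < rho & reaches v x rho]} ->
  \sum_(v <- V) weight v `^ s <= C * rho `^ (2 * s - 2).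
Proof.
move=> s12 hA; have /andP[s1 s2] := s12.
have s0 : 0 <= s by lra.
have A0 : 0 <= A by have := hA [::] isT (fun w => ltac:(by rewrite in_nil)); rewrite big_nil.
have [C C0 hC] := children_sum s12.
have ts : 0 < 2 - s by lra.
have [C' C'0 hC'] := sum_levels ts.
pose B : R := (16 / 9) `^ s * A.
have B0 : 0 <= B by rewrite mulr_ge0 ?powR_ge0.
exists (B * (C * C')); first by rewrite !mulr_ge0.
move=> x rho V /andP[rho0 rho1] uV hV.
have /choice[h hh] : forall v, exists p, v \in V ->
    exists w b u, [/\ p = rcons w b, v = p ++ u, rho <= weight w & weight p < rho].
  move=> v; have [vV|] := boolP (v \in V); last by exists [::].
  have [hv vr _] := hV _ vV.
  have ex : exists n, weight (take n v) < rho by exists (size v); rewrite take_size.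
  case: (ex_minnP ex) => [[|n]] hn nmin.
    by move: hn; rewrite take0 weight_nil ltNge rho1.
  have nv : (n < size v)%N.
    rewrite ltnNge; apply/negP => sv; have : weight (take n v) < rho.
      by rewrite take_oversize.
    by move=> /nmin; rewrite ltnn.
  exists (take n.+1 v) => _; exists (take n v), (nth 0 v n), (drop n.+1 v).
  rewrite (take_nth 0 nv) -(take_nth 0 nv) cat_take_drop; split=> //.
  by rewrite leNgt; apply/negP => /nmin; rewrite ltnn.
set P := undup (map h V).
have hP p : p \in P -> exists w b, [/\ p = rcons w b, digits w, NplusZi R b,
    rho <= weight w & weight p < rho /\ reaches p x rho].
  rewrite mem_undup => /mapP[v vV ->]; have [w [b [u [e1 e2 e3 e4]]]] := hh _ vV.
  have [hv _ hr] := hV _ vV; exists w, b.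
  have [hp hu] : digits (h v) /\ digits u by apply/digits_cat; rewrite -e2.
  have [hb hw] : NplusZi R b /\ digits w by apply/digits_rcons; rewrite -e1.
  split=> //; split=> //; apply: (@reaches_prefix _ u) => //.
  by rewrite -e2.
have hPd p : p \in P -> digits p.
  by move=> /hP[w [b [-> hw hb _ _]]]; apply/digits_rcons.
rewrite (sum_group_undup V h) -/P.
apply: (@le_trans _ _ (\sum_(p <- P) B * weight p `^ s)).
  rewrite !big_seq; apply: ler_sum => p pP; have hp := hPd _ pP.
  have p0 := weight_gt0 hp.
  rewrite -big_filter; set Vp := [seq v <- V | _].
  have eVp v : v \in Vp -> v = p ++ drop (size p) v /\ digits (drop (size p) v).
    rewrite mem_filter => /andP[/eqP hvp vV].
    have [w [b [u [e1 e2 e3 e4]]]] := hh _ vV; have [hv _ _] := hV _ vV.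
    have e5 : drop (size p) v = u by rewrite e2 hvp drop_size_cat.
    rewrite e5; split; first by rewrite {1}e2 hvp.
    by have [] : digits (h v) /\ digits u by apply/digits_cat; rewrite -e2.
  have uD : uniq (map (drop (size p)) Vp).
    rewrite map_inj_in_uniq ?filter_uniq// => v v' /eVp[e _] /eVp[e' _] d.
    by rewrite e e' d.
  have := hA _ uD; rewrite big_map => /(_ _)/(ler_wpM2l (_ : 0 <= (16 / 9 * weight p) `^ s)) hs.
  rewrite /B mulrAC -powRM; [|by lra|exact: ltW].
  apply: le_trans (hs _ _); last 2 first.
  - exact: powR_ge0.
  - by move=> u /mapP[v /eVp[_ hu] ->].
  rewrite mulr_sumr !big_seq; apply: ler_sum => v /eVp[e hd].
  have d0 := weight_gt0 hd.
  rewrite -powRM ?mulr_ge0 ?(ltW p0) ?(ltW d0)//.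
  have /andP[_ hw] := weight_cat hp hd; rewrite -e in hw.
  have v0 : 0 < weight v by apply: weight_gt0; rewrite e; apply/digits_cat.
  apply: ge0_ler_powR; rewrite ?nnegrE ?(ltW v0) ?mulr_ge0 ?(ltW p0) ?(ltW d0)//.
  by rewrite -[leRHS]mulrA.
rewrite -mulr_sumr -[leRHS]mulrA ler_wpM2l// -[leRHS]mulrA.
pose par p := take (size p).-1 p.
have parE w b : par (rcons w b) = w by rewrite /par size_rcons -cats1 take_size_cat.
rewrite (sum_group_undup P par); set Q := undup (map par P).
have hQ w : w \in Q -> [/\ digits w, rho <= weight w & reaches w x rho].
  rewrite mem_undup => /mapP[p /hP[w' [b [-> hw hb rw [_ hr]]]] ->]; rewrite parE.
  split=> //; apply: (@reaches_prefix _ [:: b]); last by rewrite cats1.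
  by apply/digits_cons.
apply: (@le_trans _ _ (\sum_(w <- Q) C * (rho `^ (2 * s - 2) * weight w `^ (2 - s)))).
  rewrite !big_seq; apply: ler_sum => w wQ; have [hw rw _] := hQ _ wQ.
  rewrite -big_filter; apply: (hC x) => //; first by rewrite filter_uniq// undup_uniq.
  move=> p; rewrite mem_filter => /andP[/eqP pw /hP[w' [b [ep hw' hb rw' [pr hr]]]]].
  by split=> //; exists b => //; rewrite ep -pw ep parE.
rewrite -mulr_sumr -mulr_sumr ler_wpM2l// mulrC ler_wpM2r ?powR_ge0//.
by apply: (hC' x rho) => //; exact: undup_uniq.
Qed.

(** Words of weight at least rho contribute a multiple of 1/r, which r <= rho^2 makes admissible.
    For the others, weight v / r >= 1 may be raised to the power s, and [sum_small_words]
    applies. *)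
Lemma covering_number_F_le (s A : R) : 1 < s < 2 ->
  (forall W : seq (seq R[i]), uniq W -> {in W, forall w, digits w} ->
    \sum_(w <- W) weight w `^ s <= A) ->
  exists2 C : R, 0 < C & forall x (rho r : R), 0 < rho <= 1 -> 0 < r <= rho ^+ 2 ->
  (covering_number r (ball x rho%:C `&` F_NplusZi R) <=
    (C * (r `^ (- s) * rho `^ (2 * s - 2)))%:E)%E.
Proof.
move=> s12 hA; have /andP[s1 s2] := s12.
have [C C0 hC] := sum_small_words s12 hA.
have [C' C'0 hC'] := sum_levels (ltr01 : 0 < (1 : R)).
exists (544 * (C' + C) + 1).
  by have := addr_ge0 C'0 C0; lra.
move=> x rho r /andP[rho0 rho1] /andP[r0 rr].
have rho2 : rho ^+ 2 <= rho by rewrite expr2 ler_piMr// ltW.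
have r1 : r <= 1 by lra.
pose P v := [/\ digits v, r <= weight v & reaches v x rho].
have [V uV VP] : exists2 V : seq (seq R[i]), uniq V & forall v, v \in V <-> P v.
  (* Each such word contributes at least r^s to a sum bounded by A, so there are finitely many. *)
  apply: (@exists_enumeration _ P (Num.truncn (A / r `^ s))) => W uW hW.
  have rs0 : 0 < r `^ s by rewrite powR_gt0.
  have h : (size W)%:R * r `^ s <= A.
    apply: le_trans (hA W uW _); last by move=> w /hW[].
    apply: (@le_trans _ _ (\sum_(w <- W) r `^ s)).
      by rewrite big_const_seq count_predT iter_addr_0 mulr_natl.
    rewrite !big_seq; apply: ler_sum => w /hW[hw rw _].
    apply: ge0_ler_powR; rewrite ?nnegrE ?(ltW r0)//; first by lra.
    exact/ltW/weight_gt0.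
  have h2 : (size W)%:R <= A / r `^ s by rewrite ler_pdivlMr.
  by rewrite truncn_ge_nat//; apply: le_trans h2.
have r01 : 0 < r <= 1 by rewrite r0.
have := @covering_number_le_weights R (ball x rho%:C `&` F_NplusZi R) r V r01.
move=> /(_ _ _ _)/le_trans; apply.
- by move=> z [].
- by move=> v /VP[].
- move=> v hv rv [y hy [By _]]; apply/VP; split=> //; exists y => //.
  by move/ballC: By; rewrite normc_distC => /ltW.
rewrite lee_fin.
set X := r `^ (- s) * rho `^ (2 * s - 2).
have X0 : 0 <= X by rewrite mulr_ge0 ?powR_ge0.
apply: (@le_trans _ _ (544 * ((C' + C) * X))); last by lra.
rewrite ler_pM2l; last by lra.
rewrite (bigID (fun v => rho <= weight v)) /= mulrDl lerD//.
- rewrite -mulr_suml -big_filter.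
  apply: (@le_trans _ _ (C' * r^-1)).
    rewrite ler_wpM2r ?invr_ge0 ?(ltW r0)//.
    rewrite (eq_big_seq (fun v => weight v `^ 1)); last first.
      move=> v; rewrite mem_filter => /andP[_ /VP[hv _ _]].
      by rewrite powRr1// ltW// weight_gt0.
    apply: (hC' x rho) => //; first exact: filter_uniq.
    by move=> v; rewrite mem_filter => /andP[rv /VP[hv _ hr]].
  rewrite ler_wpM2l//.
  have -> : X = r^-1 * (rho ^+ 2 / r) `^ (s - 1).
    exact: powR_balance_inv.
  rewrite ler_peMr ?invr_ge0 ?(ltW r0)//.
  have q1 : 1 <= rho ^+ 2 / r by rewrite ler_pdivlMr// mul1r.
  by rewrite -[leLHS](powRr0 (rho ^+ 2 / r)) ler_powR//; lra.
- rewrite -big_filter.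
  apply: (@le_trans _ _ (\sum_(v <- [seq v <- V | ~~ (rho <= weight v)])
      weight v `^ s * r `^ (- s))).
    rewrite !big_seq; apply: ler_sum => v; rewrite mem_filter => /andP[_ /VP[hv rv _]].
    have v0 := weight_gt0 hv.
    rewrite powRN -powRV ?(ltW r0)// -powRM ?(ltW v0) ?invr_ge0 ?(ltW r0)//.
    have q1 : 1 <= weight v / r by rewrite ler_pdivlMr// mul1r.
    by apply: le1r_powR => //; exact: ltW.
  rewrite -mulr_suml /X mulrCA mulrC ler_wpM2l ?powR_ge0//.
  apply: (hC x) => //; [by rewrite rho0|exact: filter_uniq|].
  by move=> v; rewrite mem_filter -ltNge => /andP[rv /VP[hv _ hr]].
Qed.

End CoveringUpperBoundSum.

(** * Packing numbers, bounds on the dimension, and pieces near 0 *)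

Section LowerBound.
Variable R : realType.
Implicit Types (x y z : R[i]) (E : set R[i]).

Lemma powR_small (e M : R) : 0 < e -> 0 < M ->
  exists2 r0 : R, 0 < r0 & forall r, 0 < r < r0 -> r `^ e < M.
Proof.
move=> e0 M0; exists (M `^ e^-1); first exact: powR_gt0.
move=> r /andP[r0 rM].
have -> : M = (M `^ e^-1) `^ e.
  by rewrite -powRrM mulVf ?gt_eqF// powRr1// ltW.
by apply: gt0_ltr_powR; rewrite ?nnegrE ?powR_ge0 ?(ltW r0).
Qed.

(** Division by r^a leaves c <= C r^(b - a), which fails for small r if a < b. *)
Lemma powR_exponent_le (a b c C r0 : R) : 0 < c -> 0 < r0 ->
  (forall r, 0 < r < r0 -> c * r `^ a <= C * r `^ b) -> b <= a.
Proof.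
move=> c0 r00 h; rewrite leNgt; apply/negP => ab.
have e0 : 0 < b - a by lra.
have C1 : 0 < `|C| + 1 by have := normr_ge0 C; lra.
have M0 : 0 < c / (`|C| + 1) by rewrite divr_gt0.
have [r1 r10 hr1] := powR_small e0 M0.
pose r := Num.min r0 r1 / 2.
have m0 : 0 < Num.min r0 r1 by rewrite lt_min r00.
have r_0 : 0 < r by rewrite /r; lra.
have [k1 k2] : Num.min r0 r1 <= r0 /\ Num.min r0 r1 <= r1.
  by rewrite !ge_min !lexx orbT.
have /h : 0 < r < r0 by apply/andP; split=> //; rewrite /r; lra.
have /hr1 : 0 < r < r1 by apply/andP; split=> //; rewrite /r; lra.
have -> : r `^ b = r `^ a * r `^ (b - a).
  by rewrite -powRD ?(gt_eqF r_0) ?implybT// addrC subrK.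
rewrite ltr_pdivlMr// => h1; rewrite mulrCA mulrC ler_pM2l ?powR_gt0//.
have : C * r `^ (b - a) <= `|C| * r `^ (b - a) by rewrite ler_wpM2r ?powR_ge0// ler_norm.
by have := powR_ge0 r (b - a); lra.
Qed.

(* Hausdorff dimension is at most lower box dimension, stated through the
   packing numbers of [E]. *)
Lemma hausdorff_measure_packing (t rho : R) E y : 0 < t -> 0 <= rho -> E !=set0 ->
  (forall x, E x -> normc (x - y) <= rho) ->
  hausdorff_measure t E <> 0%E ->
  exists2 c : R, 0 < c & forall d : R, 0 < d <= 1 ->
    exists Z : seq R[i], [/\ uniq Z, {in Z, forall z, E z}, is_separated id d Z &
      c * d `^ (- t) <= (size Z)%:R].
Proof.
move=> t0 rho0 [x0 Ex0] hE; apply: contra_notP => no.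
have small (e delta : R) : 0 < e -> 0 < delta ->
    (hausdorff_premeasure t delta E <= e%:E)%E.
  (* The first bound makes the sum of (2 d)^t over a net of fewer than c d^-t points at most e. The
     net being nonempty, d^t < c, so the second bound gives 2 d <= delta. *)
  move=> e0 delta0; pose c := Num.min (e / 2 `^ t) ((delta / 2) `^ t).
  have c0 : 0 < c by rewrite lt_min divr_gt0 ?powR_gt0//; lra.
  have [c1 c2] : c <= e / 2 `^ t /\ c <= (delta / 2) `^ t.
    by rewrite !ge_min !lexx orbT.
  have [d d01 hd] : exists2 d : R, 0 < d <= 1 & forall Z : seq R[i], uniq Z ->
      {in Z, forall z, E z} -> is_separated id d Z -> (size Z)%:R < c * d `^ (- t).
    apply: contrapT => nod; apply: no; exists c => // d d01.
    apply: contrapT => noZ; apply: nod; exists d => // Z uZ EZ sZ.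
    by rewrite ltNge; apply/negP => h; apply: noZ; exists Z.
  have /andP[d0 d1] := d01.
  have [Z [uZ EZ sZ hZ]] := exists_net d0 rho0 hE.
  have sz := hd Z uZ EZ sZ.
  have dt0 : 0 < d `^ t by rewrite powR_gt0.
  have szt : (size Z)%:R * d `^ t < c by move: sz; rewrite powRN ltr_pdivlMr.
  have Z0 : (0 < size Z)%N.
    by have [z zZ _] := hZ _ Ex0; case: Z zZ {sz szt uZ EZ sZ hZ}.
  have ddelta : 2 * d <= delta.
    rewrite leNgt; apply/negP => h.
    have : (delta / 2) `^ t <= d `^ t.
      by apply: ge0_ler_powR; rewrite ?nnegrE; lra.
    have : 1 * d `^ t <= (size Z)%:R * d `^ t by rewrite ler_pM2r// ler1n.
    by lra.
  pose U k : set R[i] := if (k < size Z)%N then ball (nth 0 Z k) d%:C else set0.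
  have dU k : (k < size Z)%N -> (diam (U k) <= (2 * d)%:E)%E.
    move=> kZ; apply: ge_ereal_sup => _ [[a b] [/= + +] <-]; rewrite /U kZ.
    move=> /ballC ha /ballC hb; rewrite lee_fin.
    apply: le_trans (normc_triangle (nth 0 Z k) _ _) _.
    by rewrite normc_distC; lra.
  apply: (@le_trans _ _ (\sum_(0 <= k <oo) diam_pow t (U k))%E).
    apply: ereal_inf_lbound; exists U => //; split.
      move=> x /hZ[z zZ xz]; exists (index z Z) => //.
      by rewrite /U index_mem zZ nth_index//; apply/ballC; rewrite normc_distC.
    move=> k; have [kZ|kZ] := ltnP k (size Z).
      by apply: le_trans (dU _ kZ) _; rewrite lee_fin.
    rewrite /U ltnNge kZ /=; apply: ge_ereal_sup => _ [[a b] [/= []]].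
  rewrite (nneseries_split 0 (size Z)); last by move=> k _; exact: diam_pow_ge0.
  rewrite add0n [X in (_ + X)%E]eseries0 ?adde0; last first.
    by move=> k kZ _; rewrite /U ltnNge kZ /= /diam_pow asboolT.
  apply: (@le_trans _ _ (\sum_(0 <= k < size Z) ((2 * d) `^ t)%:E)%E).
    rewrite !big_mkord; apply: lee_sum => k _; rewrite /diam_pow.
    case: asboolP => [_|/eqP/set0P[z Uz]]; first by rewrite lee_fin powR_ge0.
    have k0 : (0 <= diam (U k))%E.
      by apply: le_trans (diam_ge Uz Uz); rewrite subrr normc0.
    rewrite -poweR_EFin; apply: gt0_ler_poweR; rewrite ?in_itv /= ?leey ?andbT//.
    - exact: ltW.
    - by rewrite lee_fin; lra.
    - exact: dU.
  rewrite sumEFin lee_fin big_const_nat subn0 iter_addr_0 -[_ *+ size _]mulr_natl.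
  rewrite powRM; [|by lra|exact: ltW].
  have : 2 `^ t * ((size Z)%:R * d `^ t) <= 2 `^ t * (e / 2 `^ t).
    by rewrite ler_pM2l ?powR_gt0//; lra.
  rewrite [2 `^ t * (e / _)]mulrC divfK ?gt_eqF ?powR_gt0//; lra.
apply/eqP; rewrite eq_le; apply/andP; split.
- apply: ge_ereal_sup => _ [delta /= delta0 <-].
  by apply/lee_addgt0Pr => e e0; rewrite add0e; exact: small.
- apply: (@le_trans _ _ (hausdorff_premeasure t 1 E)).
    apply/ereal_infP => _ [U _ <-]; apply: nneseries_ge0 => k _ _.
    exact: diam_pow_ge0.
  by apply: ereal_sup_ubound; exists 1 => //=; exact: ltr01.
Qed.

(** Otherwise c d^-s points of F would be d-separated, whereas the unit disc holds at most 64 d^-2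
    of them. *)
Lemma hausdorff_measure_gt2 (s : R) : 2 < s -> hausdorff_measure s (F_NplusZi R) = 0%E.
Proof.
move=> s2; apply: contrapT => H.
have bd z : F_NplusZi R z -> normc (z - 0) <= 1.
  by move=> /F_NplusZi_depth/normc_depth; rewrite subr0.
have s0 : 0 < s by lra.
have [c c0 hc] := hausdorff_measure_packing s0 ler01 (F_NplusZi_nonempty R) bd H.
suff : - 2 <= - s by lra.
apply: (@powR_exponent_le _ _ c 64 1 c0) => // d /andP[d0 d1].
have /hc[Z [uZ EZ sZ hZ]] : 0 < d <= 1 by rewrite d0 ltW.
apply: le_trans hZ _.
apply: le_trans (separated_size uZ d0 ler01 sZ (fun z zZ => bd _ (EZ _ zZ))) _.
rewrite powRN powR_mulrn ?(ltW d0)// -exprVn mul1r.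
have : 1 <= d^-1 by rewrite invf_ge1// ltW.
by move: d^-1 => q q1; nra.
Qed.

Definition lattice_digit (m n : nat) : R[i] := m%:R +i* n%:R.

Lemma NplusZi_lattice_digit m n : (0 < m)%N -> NplusZi R (lattice_digit m n).
Proof. by exists m, n. Qed.

Lemma digits_lattice_digit m n : (0 < m)%N -> digits [:: lattice_digit m n].
Proof. by move=> m0; apply/digits_cons; split=> //; exact: NplusZi_lattice_digit. Qed.

Lemma normc_lattice_digit m n : normc (lattice_digit m n) <= m%:R + n%:R.
Proof. by apply: le_trans (normc_le_ReIm _) _; rewrite /= !ger0_norm. Qed.

Lemma lattice_digit_dist m n m' n' K : (m, n) <> (m', n') ->
  (m = m' %[mod K]) -> (n = n' %[mod K]) ->
  K%:R <= normc (lattice_digit m n - lattice_digit m' n').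
Proof.
have key a b : a <> b -> a = b %[mod K] -> K%:R <= `|a%:R - b%:R : R|.
  wlog ab : a b / (a <= b)%N.
    move=> h ab e; have [/h|/ltnW/h] := leqP a b; first exact.
    by rewrite distrC; apply=> // /esym.
  move=> nab /eqP; rewrite eq_sym eqn_mod_dvd// => /dvdn_leq hK.
  have l : (a < b)%N by rewrite ltn_neqAle ab andbT; apply/eqP.
  rewrite distrC -natrB// normr_nat ler_nat; apply: hK; rewrite subn_gt0//.
move=> nn em en; have [emm|/eqP nm] := eqVneq m m'.
  apply: le_trans (key _ _ _ en) _; first by move=> e; apply: nn; rewrite emm e.
  by apply: le_trans (Im_le_normc _); rewrite ImD ImN.
apply: le_trans (key _ _ nm em) _.
by apply: le_trans (Re_le_normc _); rewrite ReD ReN.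
Qed.

(** The N^2 digits with real part in [N, 2N) and imaginary part in [0, N) have weight at least 1 /
    (8 N^2), so [weight_sum_level] bounds N^(2 - 2s). N is taken about 1/r to compare powers of
    r. *)
Lemma hausdorff_measure_ge1 (s : R) : 0 <= s ->
  hausdorff_measure s (F_NplusZi R) = 0%E -> 1 <= s.
Proof.
move=> s0 H; rewrite leNgt; apply/negP => s1.
suff : 0 <= 2 * s - 2 by lra.
apply: (@powR_exponent_le _ _ (8 `^ (- s)) (2 * 64 `^ s) 1) => //.
move=> r /andP[r0 r1].
pose N := (Num.truncn r^-1).+1.
have N0 : (0 < N)%N by [].
have ri : 0 <= r^-1 by rewrite invr_ge0 ltW.
have /andP[N1 N2] := truncn_itv ri; rewrite -/N in N2.
have q1 : 1 <= r^-1 by rewrite invf_ge1// ltW.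
have N3 : N%:R <= 2 * r^-1 by rewrite /N -natr1; lra.
pose W := [seq [:: lattice_digit (N + j) k] | j <- iota 0 N, k <- iota 0 N].
have uW : uniq W.
  apply: allpairs_uniq; rewrite ?iota_uniq// => -[j k] [j' k'] _ _ /= [].
  move=> /eqP; rewrite eqr_nat eqn_add2l => /eqP -> /eqP.
  by rewrite eqr_nat => /eqP ->.
have hW w : w \in W -> exists j k, [/\ w = [:: lattice_digit (N + j) k], (j < N)%N & (k < N)%N].
  move=> /allpairsP[[j k] [jN kN ->]]; move: jN kN; rewrite !mem_iota !add0n.
  by move=> /= jN kN; exists j, k.
have hWd : {in W, forall w, digits w /\ size w = 1%N}.
  by move=> w /hW[j [k [-> _ _]]]; split=> //; apply: digits_lattice_digit; rewrite addn_gt0.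
have := weight_sum_level s0 H uW hWd.
have wl w : w \in W -> (8 * N%:R ^+ 2)^-1 <= weight w.
  move=> wW; have [j [k [e jN kN]]] := hW _ wW; have [hw _] := hWd _ wW.
  rewrite e in hw *; rewrite /weight /= addr0 mulr1.
  have -> : normc (lattice_digit (N + j) k) ^+ 2 = (N + j)%:R ^+ 2 + k%:R ^+ 2.
    by rewrite sqr_normc_ReIm.
  have Nr : 0 < N%:R :> R by rewrite ltr0n.
  have jr : j%:R <= N%:R :> R by rewrite ler_nat ltnW.
  have kr : k%:R <= N%:R :> R by rewrite ler_nat ltnW.
  have j0 : 0 <= j%:R :> R by [].
  have k0 : 0 <= k%:R :> R by [].
  rewrite natrD lef_pV2 ?posrE; first by nra.
    by rewrite mulr_gt0// exprn_gt0.
  by nra.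
have size_W : size W = (N * N)%N by rewrite size_allpairs size_iota.
move: hWd uW wl size_W; clear hW; clearbody W => hWd uW wl size_W hs.
have Nr : 0 < N%:R :> R by rewrite ltr0n.
have hs2 : (N%:R ^+ 2) * (8 * N%:R ^+ 2)^-1 `^ s <= 2 * 64 `^ s.
  apply: le_trans hs.
  apply: (@le_trans _ _ (\sum_(w <- W) (8 * N%:R ^+ 2)^-1 `^ s)).
    by rewrite big_const_seq count_predT iter_addr_0 size_W -[leRHS]mulr_natl natrM.
  rewrite !big_seq; apply: ler_sum => w wW; have [hw _] := hWd _ wW.
  apply: ge0_ler_powR; rewrite ?nnegrE ?wl// ?(ltW (weight_gt0 hw))//.
rewrite powRr0 mulr1; apply: le_trans hs2.
have -> : N%:R ^+ 2 * (8 * N%:R ^+ 2)^-1 `^ s = 8 `^ (- s) * N%:R `^ (2 - 2 * s) :> R.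
  have e8 : 0 < 8 * N%:R ^+ 2 :> R by rewrite mulr_gt0// exprn_gt0.
  rewrite powRV ?(ltW e8)// -powRN powRM ?sqr_ge0// mulrCA; congr (_ * _).
  have -> : N%:R ^+ 2 = N%:R `^ 2 :> R by rewrite powR_mulrn// ltW.
  rewrite -powRrM -powRD ?(gt_eqF Nr) ?implybT//.
  by congr (_ `^ _); ring.
rewrite ler_wpM2l ?powR_ge0//.
have -> : 2 * s - 2 = - (2 - 2 * s) by ring.
rewrite powRN -powRV ?(ltW r0)//.
by apply: ge0_ler_powR; rewrite ?nnegrE ?(ltW N2) ?(ltW Nr)//; lra.
Qed.

(* The pieces are the images of [Z] by the digits [M + K (j + k i)], j, k < J,
   which have modulus of order [M] and mutual distances at least [K]. *)
Lemma packing_near0 (M K J : nat) (sigma d : R) (Z : seq R[i]) :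
  (0 < J)%N -> (2 <= K)%N -> (K * J <= M)%N -> uniq Z -> (0 < size Z)%N ->
  {in Z, forall z, F_NplusZi R z} -> is_separated id sigma Z ->
  d <= K%:R / (32 * M%:R ^+ 2) -> d <= sigma / (16 * M%:R ^+ 2) ->
  exists2 x, F_NplusZi R x & forall rho r : R, 2 / M%:R < rho -> 2 * r <= d ->
    ((J * J * size Z)%:R%:E <= covering_number r (ball x rho%:C `&` F_NplusZi R))%E.
Proof.
move=> J0 K2 KJM uZ Z0 FZ sZ dK ds.
have M0 : (0 < M)%N by apply: leq_trans KJM; rewrite muln_gt0 J0 andbT; apply: leq_trans K2.
have Mr : 0 < M%:R :> R by rewrite ltr0n.
have Mr1 : 1 <= M%:R :> R by rewrite ler1n.
pose b (i : nat * nat) := lattice_digit (M + K * i.1) (K * i.2).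
pose f (i : nat * nat * R[i]) := cfmap [:: b i.1] i.2.
pose I := [seq (jk, z) | jk <- [seq (j, k) | j <- iota 0 J, k <- iota 0 J], z <- Z].
have hb i : digits [:: b i] by apply: digits_lattice_digit; rewrite addn_gt0 M0.
have hbN i : NplusZi R (b i) by apply: NplusZi_lattice_digit; rewrite addn_gt0 M0.
have IP i : i \in I -> [/\ (i.1.1 < J)%N, (i.1.2 < J)%N & i.2 \in Z].
  move=> /allpairsP[[jk z] [/= + zZ ->]] /=; move=> /allpairsP[[j k] [/= + + ->]].
  by rewrite !mem_iota !add0n.
have uI : uniq I.
  apply: allpairs_uniq => //; last by move=> [jk z] [jk' z'] _ _ /= [-> ->].
  apply: allpairs_uniq; rewrite ?iota_uniq//.
  by move=> [j k] [j' k'] _ _ /= [-> ->].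
have sI : size I = (J * J * size Z)%N by rewrite !size_allpairs !size_iota.
have dz i : i \in I -> 0 <= depth i.2 by move=> /IP[_ _ /FZ/F_NplusZi_depth].
have FI i : i \in I -> F_NplusZi R (f i).
  by move=> iI; apply: F_NplusZi_cfmap => //; have [_ _ /FZ] := IP _ iI.
have fE i : f i = (b i.1 + i.2)^-1 by [].
have Kr : 2 <= K%:R :> R by rewrite ler_nat.
have lt_M j : (j < J)%N -> (K * j)%:R <= M%:R :> R.
  by move=> jJ; rewrite ler_nat (leq_trans _ KJM)// leq_mul2l (ltnW jJ) orbT.
(* The digit has real part at most 2 M and imaginary part at most M, and the tail has modulus at
   most 1. *)
have up i : i \in I -> normc (b i.1 + i.2) <= 4 * M%:R.
  move=> iI; have [i1 i2 _] := IP _ iI.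
  have := normc_lattice_digit (M + K * i.1.1) (K * i.1.2).
  rewrite natrD -/(b i.1) => h.
  have := le_normcD (b i.1) i.2; have := normc_depth (dz _ iI).
  by have := lt_M _ i1; have := lt_M _ i2; lra.
have lo i : i \in I -> M%:R <= normc (b i.1 + i.2).
  move=> iI; apply: le_trans (Re_le_normc _); apply: le_trans (ler_norm _).
  by rewrite ReD /= natrD; have := Re_depth (dz _ iI); have := ler0n R (K * i.1.1); lra.
have small i : i \in I -> normc (f i) <= M%:R^-1.
  move=> iI; rewrite fE normcV lef_pV2 ?posrE ?lo//.
  exact: lt_le_trans (lo _ iI).
have far i i' (tau : R) : i \in I -> i' \in I -> 0 <= tau ->
    tau <= normc ((b i.1 + i.2) - (b i'.1 + i'.2)) ->
    tau / (16 * M%:R ^+ 2) <= normc (f i - f i').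
  move=> iI i'I tau0 ht.
  have l1 : 0 < normc (b i.1 + i.2) by apply: lt_le_trans (lo _ iI).
  have l2 : 0 < normc (b i'.1 + i'.2) by apply: lt_le_trans (lo _ i'I).
  have -> : f i - f i' = ((b i'.1 + i'.2) - (b i.1 + i.2)) /
      ((b i.1 + i.2) * (b i'.1 + i'.2)).
    by rewrite !fE; rewrite !normc_gt0 in l1 l2; field; rewrite l1 l2.
  rewrite normcM normcV normcM normc_distC; apply: ler_pM => //.
  rewrite lef_pV2 ?posrE ?mulr_gt0 ?exprn_gt0//.
  have -> : 16 * M%:R ^+ 2 = (4 * M%:R) * (4 * M%:R) :> R by ring.
  by apply: ler_pM; rewrite ?up ?ltW.
have sepI : is_separated f d I.
  move=> i i' iI i'I ii'.
  have [e1|n1] := eqVneq i.1 i'.1.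
    have n2 : i.2 != i'.2.
      apply: contraNneq ii' => e2; apply/eqP.
      by case: i i' e1 e2 {iI i'I} => [? ?] [? ?] /= -> ->.
    have [_ _ z1] := IP _ iI; have [_ _ z2] := IP _ i'I.
    have hs := sZ _ _ z1 z2 n2; rewrite /= in hs.
    have [s0|s0] := leP 0 sigma.
      apply: le_trans ds _; apply: far => //; rewrite e1.
      by have -> : b i'.1 + i.2 - (b i'.1 + i'.2) = i.2 - i'.2 by ring.
    apply: le_trans ds _; apply: (@le_trans _ _ 0); last exact: normc_ge0.
    by rewrite ler_pdivrMr ?mul0r ?(ltW s0)// mulr_gt0// exprn_gt0.
  apply: le_trans dK _.
  (* Digits K apart, with tails at most 1 apart, leave K - 1 >= K / 2 before inversion. *)
  have -> : K%:R / (32 * M%:R ^+ 2) = (K%:R / 2) / (16 * M%:R ^+ 2) :> R.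
    by field; rewrite gt_eqF.
  apply: far => //.
  have hK : K%:R <= normc (b i.1 - b i'.1).
    have K0 : (0 < K)%N by apply: leq_trans K2.
    apply: lattice_digit_dist.
    - case=> /eqP; rewrite eqn_add2l eqn_pmul2l// => /eqP e1 /eqP.
      rewrite eqn_pmul2l// => /eqP e2; move/eqP: n1; apply.
      by case: i.1 i'.1 e1 e2 => [? ?] [? ?] /= -> ->.
    - by rewrite !(mulnC K) ![(M + _)%N]addnC !modnMDl.
    - by rewrite !modnMr.
  have := depth_dist1 (dz _ iI) (dz _ i'I).
  have : normc (b i.1 - b i'.1) <=
      normc (b i.1 + i.2 - (b i'.1 + i'.2)) + normc (i.2 - i'.2).
    have -> : b i.1 - b i'.1 = (b i.1 + i.2 - (b i'.1 + i'.2)) - (i.2 - i'.2) by ring.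
    by rewrite (le_trans (le_normcD _ _))// normcN.
  by lra.
have /hasP[i0 i0I _] : has predT I.
  by rewrite has_predT sI !muln_gt0 J0 Z0.
exists (f i0); first exact: FI.
move=> rho r hrho hr; rewrite -sI; apply: (@covering_number_ge _ _ _ _ f) => //.
- move=> i iI; split; last exact: FI.
  apply/ballC; apply: le_lt_trans hrho; rewrite (le_trans (le_normcD _ _))// normcN.
  by have := small _ iI; have := small _ i0I; lra.
- by move=> i i' iI i'I ii'; apply: le_trans hr _; exact: sepI.
Qed.

End LowerBound.

(** * The spectrum in the two ranges of theta *)

Section AssouadSpectrumOfF.
Variable R : realType.
Implicit Types (theta alpha s t rho : R).

Let FR := F_NplusZi R.

Lemma powR_inv_theta theta rho a : 0 < rho -> (rho `^ (1 / theta)) `^ a = rho `^ (a / theta).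
Proof. by move=> rho0; rewrite -powRrM; congr (_ `^ _); ring. Qed.

Lemma sqr_ratio_powR theta rho : 0 < rho ->
  rho `^ (2 * (1 - 1 / theta)) = (rho / rho `^ (1 / theta)) ^+ 2.
Proof.
move=> rho0; have -> : rho / rho `^ (1 / theta) = rho `^ (1 - 1 / theta).
  by rewrite powRB ?(gt_eqF rho0) ?implybT// powRr1// ltW.
by rewrite -powR_mulrn ?powR_ge0// -powRrM mulrC.
Qed.

Lemma powR_inv_theta_le theta rho : 0 < theta < 1 -> 0 < rho <= 1 ->
  0 < rho `^ (1 / theta) <= rho.
Proof.
move=> /andP[t0 t1] rho01; have /andP[rho0 rho1] := rho01.
rewrite powR_gt0//=; apply: ge1r_powR => //.
by rewrite ler_pdivlMr// mul1r ltW.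
Qed.

Lemma powR_sqr_le theta rho : 0 < theta -> theta < 1 / 2 -> 0 < rho <= 1 ->
  rho `^ (1 / theta) <= rho ^+ 2.
Proof.
move=> t0 t1 rho01; have /andP[rho0 rho1] := rho01.
rewrite -powR_mulrn; last exact: ltW.
apply: ger_powR => //; rewrite ler_pdivlMr//; lra.
Qed.

Lemma powR_sqr_ge theta rho : 1 / 2 <= theta -> 0 < rho <= 1 ->
  rho ^+ 2 <= rho `^ (1 / theta).
Proof.
move=> t1 rho01; have /andP[rho0 rho1] := rho01.
rewrite -powR_mulrn; last exact: ltW.
have t0 : 0 < theta by lra.
apply: ger_powR => //; rewrite ler_pdivrMr//; lra.
Qed.

Lemma assouad_spectrum_le2 theta : 0 < theta < 1 -> (assouad_spectrum theta FR <= 2%:E)%E.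
Proof.
move=> t01; apply: ereal_inf_lbound; exists 2 => //; exists 64 => //.
move=> x rho _ rho01; have /andP[rho0 rho1] := rho01.
have /andP[r0 r1] := powR_inv_theta_le t01 rho01.
set r := rho `^ (1 / theta) in r0 r1 *.
pose E := ball x rho%:C `&` FR.
have hE z : E z -> normc (z - x) <= rho.
  by move=> [/ballC h _]; rewrite normc_distC ltW.
have [s [us Es ss scov]] := exists_net r0 (ltW rho0) hE.
apply: le_trans (covering_number_le scov) _; rewrite lee_fin.
apply: le_trans (separated_size us r0 (ltW rho0) ss (fun z zs => hE _ (Es _ zs))) _.
rewrite sqr_ratio_powR// -/r.
have : 1 <= rho / r by rewrite ler_pdivlMr// mul1r.
by move: (rho / r) => q q1; nra.
Qed.

Lemma assouad_spectrum_upper theta s0 s : 0 < theta -> theta < 1 / 2 ->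
  0 <= s0 -> s0 < s -> 1 < s < 2 -> hausdorff_measure s0 FR = 0%E ->
  (assouad_spectrum theta FR <= (s + theta / (1 - theta) * (2 - s))%:E)%E.
Proof.
move=> t0 t1 s00 ss s12 H0; have [A A0 hA] := weight_sum_all s00 ss H0.
have [C C0 hC] := covering_number_F_le s12 hA.
apply: ereal_inf_lbound; exists (s + theta / (1 - theta) * (2 - s)) => //.
exists C => // x rho _ rho01; have /andP[rho0 rho1] := rho01.
have r01 : 0 < rho `^ (1 / theta) <= rho ^+ 2 by rewrite powR_gt0//= powR_sqr_le.
apply: le_trans (hC x rho _ rho01 r01) _; rewrite lee_fin ler_pM2l//.
rewrite powR_inv_theta// -powRD ?(gt_eqF rho0) ?implybT//.
rewrite le_eqVlt; apply/orP; left; apply/eqP; congr (_ `^ _); field.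
by apply/andP; split; lra.
Qed.

Lemma leq_triple_half M : (2 < M)%N -> (M <= 3 * M./2)%N.
Proof. by move=> M2; rewrite -{1}(odd_double_half M); lia. Qed.

Lemma leq_double_divM M K : (0 < K <= M)%N -> (M <= 2 * (K * (M %/ K)))%N.
Proof.
move=> /andP[K0 KM]; rewrite {1}(divn_eq M K).
have : (K <= K * (M %/ K))%N by rewrite leq_pmulr// divn_gt0.
by have := ltn_pmod M K0; rewrite (mulnC K); lia.
Qed.

Lemma nat_above (a : R) : 1 <= a -> exists2 M : nat, (0 < M)%N & a < M%:R <= a + 1.
Proof.
move=> a1; exists (Num.truncn a).+1 => //.
have /andP[h1 h2] := truncn_itv (le_trans ler01 a1).
by rewrite h2 /= -natr1 lerD2r.
Qed.

(** [packing_near0] with K = 2 keeps a positive proportion of the digits. The packing scale [sigma]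
    is of order r / rho^2, which tends to 0 because theta < 1/2. *)
Lemma assouad_spectrum_lower theta t : 0 < theta -> theta < 1 / 2 ->
  0 < t -> hausdorff_measure t FR <> 0%E ->
  ((t + theta / (1 - theta) * (2 - t))%:E <= assouad_spectrum theta FR)%E.
Proof.
move=> th0 th1 t0 Ht.
have bd z : FR z -> normc (z - 0) <= 1.
  by move=> /F_NplusZi_depth/normc_depth; rewrite subr0.
have [c c0 hc] := hausdorff_measure_packing t0 ler01 (F_NplusZi_nonempty R) bd Ht.
apply/ereal_infP => _ [alpha [C C0 hC] <-]; rewrite lee_fin.
have e0 : 0 < 1 / theta - 2 by rewrite subr_gt0 ltr_pdivlMr//; lra.
(* Since M <= 3 / rho, sigma = L r / rho^2 satisfies 2 r <= sigma / (16 M^2) once L >= 32 * 9. *)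
have [L LK] : exists L : R, 32 * 9 <= L by exists (32 * 9).
have L0 : 0 < L by lra.
have n0 : 0 < L^-1 by rewrite invr_gt0.
have [r1 r10 hr1] := powR_small e0 n0.
(* There are at least (3 rho)^-2 images with c sigma^-t points each; with r = rho^(1 / theta) this
   is a power of rho. *)
have key : alpha * (1 - 1 / theta) <= - 2 + 2 * t - t / theta.
  have cc : 0 < c * L `^ (- t) / 9 
    by apply: divr_gt0; [apply: mulr_gt0 => //; exact: powR_gt0|clear; lra].
  have m0 : 0 < Num.min r1 1 by rewrite lt_min r10 ltr01.
  apply: (@powR_exponent_le _ _ _ _ C _ cc m0) => rho /andP[rho0].
  rewrite lt_min => /andP[rhor rho1].
  have rho01 : 0 < rho <= 1 by rewrite rho0 ltW.
  have /hr1 : 0 < rho < r1 by rewrite rho0.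
  set r := rho `^ (1 / theta).
  have -> : rho `^ (1 / theta - 2) = r / rho ^+ 2.
    by rewrite powRB ?(gt_eqF rho0) ?implybT// powR_mulrn// ltW.
  move=> hr.
  have r0 : 0 < r by rewrite powR_gt0.
  have q2 : 0 < rho ^+ 2 by rewrite exprn_gt0.
  pose sigma := L * (r / rho ^+ 2).
  have sigma01 : 0 < sigma <= 1.
    by rewrite /sigma mulr_gt0 ?divr_gt0//= -ler_pdivlMl// mulr1 ltW.
  have [Z [uZ FZ sZ hZ]] := hc _ sigma01; have /andP[sigma0 _] := sigma01.
  have Z0 : (0 < size Z)%N.
    by rewrite -(ltr0n R); apply: lt_le_trans hZ; rewrite mulr_gt0// powR_gt0.
  have a1 : 2 <= 2 / rho by rewrite ler_pdivlMr//; lra.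
  have [|M M0 /andP[M1 M2]] := @nat_above (2 / rho); first by lra.
  have Mr : 0 < M%:R :> R by rewrite ltr0n.
  have M3 : M%:R <= 3 / rho.
    have : 1 <= 1 / rho by rewrite ler_pdivlMr// mul1r ltW.
    by lra.
  have M2n : (2 < M)%N by rewrite -(ltr_nat R); lra.
  have J0 : (0 < M./2)%N by rewrite half_gt0 ltnW.
  have KJ : (2 * M./2 <= M)%N by rewrite mul2n -{2}(odd_double_half M) leq_addl.
  have J3 : M%:R <= 3 * (M./2)%:R :> R.
    by have := leq_triple_half M2n; rewrite -(ler_nat R) natrM.
  have rhoM : rho ^+ 2 * M%:R ^+ 2 <= 9.
    rewrite -exprMn -[9](_ : 3 ^+ 2 = 9); last by ring.
    rewrite ler_sqr ?nnegrE ?mulr_ge0 ?(ltW rho0)//.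
    by rewrite mulrC -ler_pdivlMr.
  have hd : L * r <= rho ^+ 2 by move: hr; rewrite ltr_pdivrMr// -ltr_pdivrMl ?invr_gt0// invrK => /ltW.
  have M20 : 0 < M%:R ^+ 2 :> R by rewrite exprn_gt0.
  have d1 : 2 * r <= 2%:R / (32 * M%:R ^+ 2).
    rewrite ler_pdivlMr ?mulr_gt0//.
    have h1 : L * r * M%:R ^+ 2 <= rho ^+ 2 * M%:R ^+ 2 by rewrite ler_pM2r.
    have h2 : 32 * 9 * (r * M%:R ^+ 2) <= L * (r * M%:R ^+ 2).
      by rewrite ler_pM2r// mulr_gt0.
    by move: (M%:R ^+ 2) h1 h2 rhoM => X; clear; lra.
  have d2 : 2 * r <= sigma / (16 * M%:R ^+ 2).
    rewrite ler_pdivlMr ?mulr_gt0// /sigma.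
    rewrite mulrA ler_pdivlMr//.
    have h1 : r * (rho ^+ 2 * M%:R ^+ 2) <= r * 9 by rewrite ler_pM2l.
    have h2 : 32 * 9 * r <= L * r by rewrite ler_pM2r.
    by move: (M%:R ^+ 2) h1 h2 => X; clear; lra.
  have [x Fx hx] := packing_near0 J0 (leqnn 2) KJ uZ Z0 FZ sZ d1 d2.
  have := hC x rho Fx rho01.
  have hM : 2 / M%:R < rho by rewrite ltr_pdivrMr// mulrC -ltr_pdivrMr.
  move=> /(le_trans (hx rho r hM (lexx _))); rewrite lee_fin; apply: le_trans.
  rewrite !natrM.
  apply: (@le_trans _ _ ((9 * rho ^+ 2)^-1 * (c * sigma `^ (- t)))).
    rewrite le_eqVlt; apply/orP; left; apply/eqP.
    have -> : rho `^ (- 2 + 2 * t - t / theta) =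
        (rho ^+ 2)^-1 * (r / rho ^+ 2) `^ (- t).
      rewrite powRM ?invr_ge0 ?(ltW r0) ?(ltW q2)// powRV ?(ltW q2)//.
      rewrite -powRN opprK powR_exprn ?(ltW rho0)// -powR_mulrn ?powR_ge0// -powRrM.
      rewrite /r powR_inv_theta// -[rho ^+ 2]powR_mulrn ?(ltW rho0)// -powRN.
      rewrite -!powRD ?(gt_eqF rho0) ?implybT//; congr (_ `^ _); ring.
    rewrite /sigma [in RHS]powRM ?divr_ge0 ?(ltW r0) ?(ltW q2) ?(ltW L0)//.
    by field; rewrite gt_eqF.
  apply: ler_pM => //.
  - by rewrite invr_ge0 mulr_ge0 ?sqr_ge0.
  - by rewrite mulr_ge0 ?powR_ge0// ltW.
  have -> : (9 * rho ^+ 2)^-1 = (3 * rho)^-1 * (3 * rho)^-1.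
    by rewrite -invfM; congr _^-1; ring.
  have Jl : (3 * rho)^-1 <= (M./2)%:R.
    have : 2 / rho <= 3 * (M./2)%:R by apply: le_trans J3; exact: ltW.
    rewrite invfM; have : 0 < rho^-1 by rewrite invr_gt0.
    lra.
  by apply: ler_pM; rewrite ?invr_ge0 ?mulr_ge0 ?(ltW rho0).
have q0 : theta != 0 by rewrite gt_eqF.
have q1 : 1 - theta != 0 by rewrite gt_eqF//; lra.
have -> : t + theta / (1 - theta) * (2 - t) =
    (- 2 + 2 * t - t / theta) * (- theta / (1 - theta)).
  by field; rewrite ?q0 ?q1.
have -> : alpha = alpha * (1 - 1 / theta) * (- theta / (1 - theta)).
  by field; rewrite ?q0 ?q1.
rewrite ler_wnM2r// mulNr oppr_le0 divr_ge0//; lra.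
Qed.

(** One point per digit suffices. Digits spaced by K of order r / rho^2, at least 1 as theta >= 1/2,
    have images about K rho^2, that is r, apart, and about (M / K)^2, that is (rho / r)^2, of them
    remain. *)
Lemma assouad_spectrum_ge2 theta : 1 / 2 <= theta -> theta < 1 ->
  (2%:E <= assouad_spectrum theta FR)%E.
Proof.
move=> th0 th1; have th00 : 0 < theta by lra.
have th01 : 0 < theta < 1 by rewrite th00.
have [z0 Fz0] := F_NplusZi_nonempty R.
apply/ereal_infP => _ [alpha [C C0 hC] <-]; rewrite lee_fin.
have e0 : 0 < 1 / theta - 1 by rewrite subr_gt0 ltr_pdivlMr//; lra.
(* 64 * 9 comes from 64 r M^2 <= K with M <= 3 / rho; the 1 absorbs the rounding of K, as r / rho^2
   >= 1. *)
have [D DK] : exists D : R, 64 * 9 + 1 <= D by exists (64 * 9 + 1).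
have D0 : 0 < D by lra.
have n0 : 0 < D^-1 by rewrite invr_gt0.
have [r1 r10 hr1] := powR_small e0 n0.
have key : alpha * (1 - 1 / theta) <= 2 * (1 - 1 / theta).
  have cc : 0 < D^-1 ^+ 2 by rewrite exprn_gt0.
  have m0 : 0 < Num.min r1 1 by rewrite lt_min r10 ltr01.
  apply: (@powR_exponent_le _ _ _ _ C _ cc m0) => rho /andP[rho0].
  rewrite lt_min => /andP[rhor rho1].
  have rho01 : 0 < rho <= 1 by rewrite rho0 ltW.
  have /hr1 : 0 < rho < r1 by rewrite rho0.
  have rsq := powR_sqr_ge th0 rho01.
  rewrite sqr_ratio_powR//.
  have -> : rho `^ (1 / theta - 1) = rho `^ (1 / theta) / rho.
    by rewrite powRB ?(gt_eqF rho0) ?implybT// powRr1// ltW.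
  have := hC; set r := rho `^ (1 / theta) in rsq * => {}hC hr.
  have r0 : 0 < r by rewrite powR_gt0.
  have q2 : 0 < rho ^+ 2 by rewrite exprn_gt0.
  have a1 : 2 <= 2 / rho by rewrite ler_pdivlMr//; lra.
  have [|M M0 /andP[M1 M2]] := @nat_above (2 / rho); first by lra.
  have Mr : 0 < M%:R :> R by rewrite ltr0n.
  have M3 : M%:R <= 3 / rho.
    have : 1 <= 1 / rho by rewrite ler_pdivlMr// mul1r ltW.
    by lra.
  have M20 : 0 < M%:R ^+ 2 :> R by rewrite exprn_gt0.
  have rhoM : rho ^+ 2 * M%:R ^+ 2 <= 9.
    rewrite -exprMn -[9](_ : 3 ^+ 2 = 9); last by ring.
    rewrite ler_sqr ?nnegrE ?mulr_ge0 ?(ltW rho0)//.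
    by rewrite mulrC -ler_pdivlMr.
  have q1 : 1 <= r / rho ^+ 2 by rewrite ler_pdivlMr// mul1r.
  have [|K K0 /andP[K1 K2]] := @nat_above (64 * (9 * (r / rho ^+ 2))); first by lra.
  have Kr : 0 < K%:R :> R by rewrite ltr0n.
  have K3 : K%:R <= D * (r / rho ^+ 2).
    have : (64 * 9 + 1) * (r / rho ^+ 2) <= D * (r / rho ^+ 2).
      by rewrite ler_wpM2r// ltW// divr_gt0.
    by move: K2 q1; clear; move: (r / _) => q; lra.
  have K2n : (2 <= K)%N by rewrite -(ler_nat R); lra.
  have K4 : K%:R * (rho / r) * rho <= D.
    have : K%:R * (rho ^+ 2 / r) <= D * (r / rho ^+ 2) * (rho ^+ 2 / r).
      by rewrite ler_pM2r// divr_gt0.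
    have -> : D * (r / rho ^+ 2) * (rho ^+ 2 / r) = D.
      by field; rewrite !gt_eqF.
    have -> // : K%:R * (rho / r) * rho = K%:R * (rho ^+ 2 / r) by rewrite expr2; ring.
  have rrK : D < rho / r.
    by rewrite -(invrK D) -(invrK (rho / r)) ltf_pV2 ?posrE ?invr_gt0 ?divr_gt0// invf_div.
  (* K <= D r / rho^2 and r / rho < 1 / D give K < 1 / rho < M. *)
  have KM : (K <= M)%N.
    rewrite -(ler_nat R); apply: le_trans (ltW M1); rewrite ler_pdivlMr//.
    apply: (@le_trans _ _ 1); last by clear; lra.
    rewrite -(ler_pM2r D0) mul1r; apply: le_trans K4.
    by rewrite [leRHS]mulrAC ler_pM2l ?mulr_gt0// ltW.
  pose J := (M %/ K)%N.
  have J0 : (0 < J)%N by rewrite divn_gt0.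
  have KJ : (K * J <= M)%N by rewrite mulnC leq_divM.
  have JM : M%:R <= 2 * (K%:R * J%:R) :> R.
    have KM' : (0 < K <= M)%N by rewrite K0.
    by have := leq_double_divM KM'; rewrite -(ler_nat R) !natrM.
  have d1 : 2 * r <= K%:R / (32 * M%:R ^+ 2).
    rewrite ler_pdivlMr ?mulr_gt0//; apply: le_trans (ltW K1).
    rewrite [64 * _]mulrA [64 * 9 * _]mulrA ler_pdivlMr//.
    have -> : 2 * r * (32 * M%:R ^+ 2) * rho ^+ 2 = 64 * (r * (rho ^+ 2 * M%:R ^+ 2)) by ring.
    have -> : 64 * 9 * r = 64 * (r * 9) by ring.
    by rewrite ler_pM2l// ler_pM2l.
  (* A one-point list is separated at every scale, so [sigma] is whatever [packing_near0] asks
     for. *)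
  pose sigma := 32 * r * M%:R ^+ 2.
  have d2 : 2 * r <= sigma / (16 * M%:R ^+ 2).
    by rewrite ler_pdivlMr ?mulr_gt0// /sigma; lra.
  have FZ : {in [:: z0], forall z, FR z} by move=> z; rewrite inE => /eqP->.
  have sZ : is_separated id sigma [:: z0].
    by move=> a b; rewrite !inE => /eqP-> /eqP->; rewrite eqxx.
  have [x Fx hx] := packing_near0 J0 K2n KJ (isT : uniq [:: z0]) (isT : (0 < size [:: z0])%N)
    FZ sZ d1 d2.
  have hM : 2 / M%:R < rho by rewrite ltr_pdivrMr// mulrC -ltr_pdivrMr.
  have := hC x rho Fx rho01; rewrite -/r.
  move=> /(le_trans (hx rho r hM (lexx _))); rewrite lee_fin; apply: le_trans.
  rewrite muln1 natrM -exprMn expr2.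
  have Jl : D^-1 * (rho / r) <= J%:R.
    have h1 : 2 <= M%:R * rho by rewrite -ler_pdivrMr// ltW.
    have h2 : M%:R * rho <= 2 * (K%:R * J%:R) * rho by rewrite ler_pM2r.
    have h3 := ler_wpM2r (ler0n R J) K4.
    have h4 : 0 < rho / r by rewrite divr_gt0.
    rewrite ler_pdivrMl//.
    apply: le_trans h3.
    have -> : K%:R * (rho / r) * rho * J%:R = (rho / r) * (K%:R * J%:R * rho) by ring.
    rewrite -[leLHS]mulr1 ler_pM2l//.
    by move: (le_trans h1 h2); clear; lra.
  have k0 : 0 <= D^-1 * (rho / r).
    by apply: mulr_ge0; [exact: ltW|exact/ltW/divr_gt0].
  exact: ler_pM.
have m0 : 1 - 1 / theta < 0 by lra.
by move: key; rewrite ler_nM2r.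
Qed.

Lemma hausdorff_dim_F : exists2 h : R, hausdorff_dim FR = h%:E &
  [/\ 1 <= h <= 2, forall t, 0 <= t < h -> hausdorff_measure t FR <> 0%E &
    forall s, h < s -> exists2 s0, 0 <= s0 < s & hausdorff_measure s0 FR = 0%E].
Proof.
have lo : (1%:E <= hausdorff_dim FR)%E.
  by apply/ereal_infP => _ [s [s0 Hs] <-]; rewrite lee_fin; exact: hausdorff_measure_ge1 Hs.
have up : (hausdorff_dim FR <= 2%:E)%E.
  apply/lee_addgt0Pr => e e0; apply: ereal_inf_lbound; exists (2 + e) => //.
  by split; [lra|apply: hausdorff_measure_gt2; lra].
have /fineK hE : hausdorff_dim FR \is a fin_num.
  by rewrite fin_numE; case: (hausdorff_dim FR) lo up.
exists (fine (hausdorff_dim FR)) => //; split.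
- by rewrite -!lee_fin hE lo up.
- move=> t /andP[t0]; rewrite -lte_fin hE ltNge => /negP th Ht; apply: th.
  by apply: ereal_inf_lbound; exists t.
- move=> s; rewrite -lte_fin hE => /ereal_inf_lt[_ [s0 [s00 Hs] <-]] ss.
  by exists s0 => //; rewrite s00 -lte_fin.
Qed.

End AssouadSpectrumOfF.

Theorem proposition6p5 (R : realType) (theta : R) :
  0 < theta < 1 ->
  let F := F_NplusZi R in
  let h : \bar R := hausdorff_dim F in
  (theta < 1 / 2 ->
     assouad_spectrum theta F =
       (h + (theta / (1 - theta))%:E * (2%:E - h))%E) /\
  (1 / 2 <= theta -> assouad_spectrum theta F = 2%:E).
Proof.
move=> th01 F h; have /andP[th0 th1] := th01; split=> th; last first.
  apply/eqP; rewrite eq_le assouad_spectrum_le2//=.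
  exact: assouad_spectrum_ge2.
have [d hd [/andP[d1 d2] hlow hup]] := hausdorff_dim_F R.
rewrite /h /F hd -EFinB -EFinM -EFinD; set k := theta / (1 - theta).
have k0 : 0 < k by rewrite divr_gt0//; lra.
have k1 : k < 1 by rewrite ltr_pdivrMr; lra.
apply/eqP; rewrite eq_le; apply/andP; split.
(* The weight sums require an exponent s with h < s < 2; for h = 2 the formula reduces to the
   trivial bound 2. *)
- have [->|nd] := eqVneq d 2.
    by rewrite subrr mulr0 addr0; exact: assouad_spectrum_le2.
  have d2' : d < 2 by rewrite lt_neqAle nd.
  apply/lee_addgt0Pr => e e0.
  pose s := d + Num.min e (2 - d) / 2.
  have m0 : 0 < Num.min e (2 - d) by rewrite lt_min e0 subr_gt0.
  have [m1 m2] : Num.min e (2 - d) <= e /\ Num.min e (2 - d) <= 2 - d.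
    by rewrite !ge_min !lexx orbT.
  have ds : d < s by rewrite /s; lra.
  have [s0 /andP[s00 ss] Hs] := hup _ ds.
  have s12 : 1 < s < 2 by apply/andP; split; rewrite /s; lra.
  apply: le_trans (assouad_spectrum_upper th0 th s00 ss s12 Hs) _.
  rewrite -/k -EFinD lee_fin.
  have : k * (2 - s) <= k * (2 - d) by rewrite ler_pM2l//; lra.
  have : s <= d + e by rewrite /s; lra.
  lra.
(* This t is positive, below d and within e of it. Since 0 < k < 1, the exponent (1 - k) t + 2 k
   then loses at most e. *)
- apply/lee_addgt0Pr => e e0; pose t := Num.max (d / 2) (d - e).
  have t1 : d / 2 <= t by rewrite le_max lexx.
  have t2 : d - e <= t by rewrite le_max lexx orbT.
  have t3 : t < d by rewrite gt_max; apply/andP; split; lra.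
  have t0 : 0 < t by lra.
  have t0d : 0 <= t < d by rewrite ltW.
  have := assouad_spectrum_lower th0 th t0 (hlow _ t0d).
  move=> /(fun h => leeD2r e%:E h); apply: le_trans.
  rewrite -EFinD lee_fin -/k; clearbody t k.
  have : 0 <= (1 - k) * (e - (d - t)) by rewrite mulr_ge0//; lra.
  have : 0 <= k * e by rewrite mulr_ge0// ltW.
  lra.
Qed.
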